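(* Let $(X_0,X_1)$ be a compatible couple and let $b\in SV(0,\infty)\cap AC(0,\infty)$ satisfy $$b\ \text{is strictly decreasing},\quad b(0)<\infty,\quad b(\infty)=0.$$ Let $\beta\in SV(0,\infty)\cap AC(0,\infty)$ be such that $$\beta\ \text{is strictly decreasing},\quad \beta(0)=\infty,\quad \beta(\infty)=0,$$ and assume that $B\in SV(0,\infty)$ is given by $$B(x):=b(x)\ \text{ if } x\in[1,\infty),\qquad B(x):=c\,\beta(x)\ \text{ if } x\in(0,1),$$ where $c$ is a positive constant chosen in such a way that $B\in AC(0,\infty)$. If $$A(x):=\frac{B^2(x)}{x(-B'(x))}\quad\text{for a.a. } x>0,$$ then $$(X_0,X_1)_{0,\infty,b;K}=(X_0,X_0+X_1)_{0,\infty,B;K}=(X_0,X_0+X_1)_{0,\infty,A;J}.$$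
   Context: A pair $(X_0,X_1)$ of Banach spaces is a compatible couple if there is a Hausdorff topological vector space in which both $X_0$ and $X_1$ are continuously embedded. $X_0\cap X_1$ carries the norm $\max\{\|f\|_{X_0},\|f\|_{X_1}\}$ and $X_0+X_1$ the norm $\inf\{\|f_0\|_{X_0}+\|f_1\|_{X_1}: f=f_0+f_1\}$. For $t>0$, $$K(f,t;X_0,X_1):=\inf\{\|f_0\|_{X_0}+t\|f_1\|_{X_1}: f=f_0+f_1,\ f_0\in X_0,\ f_1\in X_1\}\quad (f\in X_0+X_1),$$ $$J(f,t;X_0,X_1):=\max\{\|f\|_{X_0},t\|f\|_{X_1}\}\quad (f\in X_0\cap X_1).$$ $\|\cdot\|_{\infty,(c,d)}$ is the $L_\infty$-norm (essential supremum) on $(c,d)$. For a measurable non-negative weight $v$ on $(0,\infty)$: - $(X_0,X_1)_{0,\infty,v;K}$ is the set of $f\in X_0+X_1$ with $\|f\|_{0,\infty,v;K}:=\|v(t)K(f,t;X_0,X_1)\|_{\infty,(0,\infty)}<\infty$. - $(X_0,X_1)_{0,\infty,v;J}$ is the set of $f\in X_0+X_1$ for which there is a strongly measurable $u:(0,\infty)\to X_0\cap X_1$ with $f=\int_0^\infty u(s)\,\frac{ds}{s}$ (convergence in $X_0+X_1$) and for which $\|f\|_{0,\infty,v;J}:=\inf\|v(t)J(u(t),t;X_0,X_1)\|_{\infty,(0,\infty)}$ is finite, the infimum being over all such representations of $f$. The convention $a/0=\infty$ for $a\in(0,\infty)$ is used (and $0\cdot\infty=0$ in the weighted norms). The same definitions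 are used for the compatible couple $(X_0,X_0+X_1)$. Equality of two spaces means that they are equal as sets and their norms are equivalent. $SV(0,\infty)$ is the set of slowly varying functions: positive, finite, Lebesgue-measurable functions $b$ on $(0,\infty)$ such that for each $\varepsilon>0$, $t^{\varepsilon}b(t)$ is equivalent to a non-decreasing function on $(0,\infty)$ and $t^{-\varepsilon}b(t)$ is equivalent to a non-increasing function on $(0,\infty)$ (two non-negative functions are equivalent if each is bounded by a positive constant multiple of the other). $AC(0,\infty)$ is the set of functions that are absolutely continuous on every compact subinterval of $(0,\infty)$. For monotone $f$ on $(0,\infty)$, $f(0):=\lim_{t\to0+}f(t)$ and $f(\infty):=\lim_{t\to\infty}f(t)$. *)

(* Defs.v *)
From HB Require Import structures.
From mathcomp Require Import all_boot all_order all_algebra.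
From mathcomp Require Import all_classical all_reals all_analysis.
From mathcomp Require Import measurable_realfun.

Set Implicit Arguments.
Unset Strict Implicit.
Unset Printing Implicit Defensive.

Import Order.TTheory GRing.Theory Num.Theory.
Import numFieldNormedType.Exports.

Local Open Scope classical_set_scope.
Local Open Scope ring_scope.

(** Normed spaces sitting inside a vector space [Z]. All the spaces of the
    theory (X0, X1, X0 + X1, the interpolation spaces) are subsets of one
    ambient space, each with its own norm, so they are represented by a carrier
    and a norm. The norm is only meaningful on the carrier; it is extended-real
    valued so that infima and suprema need no side condition. *)
Record nspace (R : realType) (Z : lmodType R) := NSpace {
  carrier :> set Z ;
  nrm : Z -> \bar R }.

(* Over the carrier of [embedded i], with [i] injective, the infimum ranges over
   a singleton: the norm of [i x] is the norm of [x]. *)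
Definition embedded (R : realType) (Z : lmodType R) (X : normedModType R)
    (i : X -> Z) : nspace Z :=
  NSpace (range i) (fun z => ereal_inf [set `|x|%:E | x in i @^-1` [set z]]).

Definition decomp (R : realType) (Z : lmodType R) (E0 E1 : nspace Z) (f : Z) :
    set (Z * Z) :=
  [set p | [/\ carrier E0 p.1, carrier E1 p.2 & f = p.1 + p.2]].

Definition sum_space (R : realType) (Z : lmodType R) (E0 E1 : nspace Z) :
    nspace Z :=
  NSpace [set f | decomp E0 E1 f !=set0]
    (fun f => ereal_inf
       [set (nrm E0 p.1 + nrm E1 p.2)%E | p in decomp E0 E1 f]).

Definition cap_space (R : realType) (Z : lmodType R) (E0 E1 : nspace Z) :
    nspace Z :=
  NSpace (carrier E0 `&` carrier E1)
    (fun f => Order.max (nrm E0 f) (nrm E1 f)).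

Definition same_space (R : realType) (Z : lmodType R) (E F : nspace Z) : Prop :=
  carrier E = carrier F /\
  exists2 C : R, 0 < C & forall f, carrier E f ->
    (nrm E f <= C%:E * nrm F f)%E /\ (nrm F f <= C%:E * nrm E f)%E.

(** A function is [mu]-simple on [D] with values in [E] when it takes finitely
    many values on [D], each on a measurable set. On the real line measurable
    means Borel; since the notions below are only up to null sets, Borel and
    Lebesgue measurable sets yield the same strongly measurable functions and
    the same Bochner integral. *)
Definition simple_on d (T : measurableType d) (R : realType) (Z : lmodType R)
    (D : set T) (E : nspace Z) (s : T -> Z) : Prop :=
  [/\ s @` D `<=` carrier E, finite_set (s @` D) &
      forall z, measurable (D `&` s @^-1` [set z])].

Definition strongly_measurable d (T : measurableType d) (R : realType)
    (mu : {measure set T -> \bar R}) (Z : lmodType R)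
    (D : set T) (E : nspace Z) (u : T -> Z) : Prop :=
  u @` D `<=` carrier E /\
  exists s : nat -> T -> Z,
    (forall n, simple_on D E (s n)) /\
    {ae mu, forall t, D t -> nrm E (u t - s n t) @[n --> \oo] --> 0%E}.

Definition simple_integral d (T : measurableType d) (R : realType)
    (mu : {measure set T -> \bar R}) (Z : lmodType R)
    (D : set T) (s : T -> Z) : Z :=
  \sum_(z \in s @` D) fine (mu (D `&` s @^-1` [set z])) *: z.

(** [f] is the Bochner integral of [u] over [D], in the normed space [E]. The
    library integral of a nonnegative function is a supremum over simple
    functions below it, so it is also correct for integrands that are only
    almost everywhere equal to a Borel function. *)
Definition is_bochner_integral d (T : measurableType d) (R : realType)
    (mu : {measure set T -> \bar R}) (Z : lmodType R)
    (D : set T) (E : nspace Z) (u : T -> Z) (f : Z) : Prop :=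
  [/\ strongly_measurable mu D E u, carrier E f &
    exists s : nat -> T -> Z,
      [/\ forall n, simple_on D E (s n),
          forall n z, z != 0 -> (mu (D `&` (s n) @^-1` [set z]) < +oo)%E,
          (\int[mu]_(t in D) nrm E (u t - s n t))%E @[n --> \oo] --> 0%E &
          nrm E (f - simple_integral mu D (s n)) @[n --> \oo] --> 0%E]].

Definition Kfun (R : realType) (Z : lmodType R) (E0 E1 : nspace Z)
    (f : Z) (t : R) : \bar R :=
  ereal_inf [set (nrm E0 p.1 + t%:E * nrm E1 p.2)%E | p in decomp E0 E1 f].

Definition Jfun (R : realType) (Z : lmodType R) (E0 E1 : nspace Z)
    (f : Z) (t : R) : \bar R :=
  Order.max (nrm E0 f) (t%:E * nrm E1 f)%E.

(* The restriction [\_] extends [g] by 0 outside (0, oo). *)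
Definition Linfty (R : realType) (g : R -> \bar R) : \bar R :=
  ('N[@lebesgue_measure R]_+oo[g \_ `]0%R, +oo[])%E.

(** Weights are extended-real valued, since a weight given by a quotient
    may take the value +oo; in [\bar R], [0 * +oo = 0]. *)
Definition Kspace (R : realType) (Z : lmodType R) (E0 E1 : nspace Z)
    (v : R -> \bar R) : nspace Z :=
  let N f := Linfty (fun t => (v t * Kfun E0 E1 f t)%E) in
  NSpace [set f | carrier (sum_space E0 E1) f /\ (N f < +oo)%E] N.

(** [f] is the integral over (0, oo) of [u s] with respect to [ds / s],
    where [u] is strongly measurable into the intersection and the integral is
    taken in the sum. *)
Definition represents (R : realType) (Z : lmodType R) (E0 E1 : nspace Z)
    (u : R -> Z) (f : Z) : Prop :=
  strongly_measurable (@lebesgue_measure R) `]0, +oo[ (cap_space E0 E1) u /\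
  is_bochner_integral (@lebesgue_measure R) `]0, +oo[ (sum_space E0 E1)
    (fun s => s^-1 *: u s) f.

Definition Jspace (R : realType) (Z : lmodType R) (E0 E1 : nspace Z)
    (v : R -> \bar R) : nspace Z :=
  let N f := ereal_inf [set Linfty (fun t => (v t * Jfun E0 E1 (u t) t)%E)
                       | u in [set u | represents E0 E1 u f]] in
  NSpace [set f | [/\ carrier (sum_space E0 E1) f,
                      exists u, represents E0 E1 u f & (N f < +oo)%E]] N.

(** Functions on (0, oo) are functions [R -> R] whose values on the
    nonpositive reals are ignored. *)
Definition lebesgue_measurable_pos (R : realType) (f : R -> R) : Prop :=
  forall Y : set R, measurable Y ->
    completed_algebra_gen (@lebesgue_measure R) (`]0, +oo[ `&` f @^-1` Y).

Definition nondecreasing_pos (R : realType) (f : R -> R) : Prop :=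
  forall x y, 0 < x -> x <= y -> f x <= f y.

Definition nonincreasing_pos (R : realType) (f : R -> R) : Prop :=
  forall x y, 0 < x -> x <= y -> f y <= f x.

Definition strictly_decreasing_pos (R : realType) (f : R -> R) : Prop :=
  forall x y, 0 < x -> x < y -> f y < f x.

Definition equivalent_pos (R : realType) (f g : R -> R) : Prop :=
  exists2 C : R, 0 < C &
    forall t, 0 < t -> f t <= C * g t /\ g t <= C * f t.

Definition slowly_varying (R : realType) (b : R -> R) : Prop :=
  [/\ forall t, 0 < t -> 0 < b t,
      lebesgue_measurable_pos b &
      forall eps : R, 0 < eps ->
        (exists g, [/\ forall t, 0 < t -> 0 <= g t, nondecreasing_pos g &
                       equivalent_pos (fun t => t `^ eps * b t) g]) /\
        (exists g, [/\ forall t, 0 < t -> 0 <= g t, nonincreasing_pos g &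
                       equivalent_pos (fun t => t `^ (- eps) * b t) g])].

Definition abs_continuous_on (R : realType) (a c : R) (f : R -> R) : Prop :=
  forall eps : R, 0 < eps -> exists2 delta : R, 0 < delta &
    forall (n : nat) (x y : 'I_n -> R),
      (forall i, [/\ a <= x i, x i <= y i & y i <= c]) ->
      trivIset setT (fun i => `]x i, y i[%classic) ->
      \sum_i (y i - x i) < delta -> \sum_i `|f (y i) - f (x i)| < eps.

Definition locally_abs_continuous (R : realType) (f : R -> R) : Prop :=
  forall a c : R, 0 < a -> a <= c -> abs_continuous_on a c f.

(** The values f(0) and f(oo) of a monotone function on (0, oo). *)
Definition at_zero (R : realType) (f : R -> R) : \bar R :=
  lim ((f t)%:E @[t --> 0^'+]).

Definition at_infty (R : realType) (f : R -> R) : \bar R :=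
  lim ((f t)%:E @[t --> +oo]).

(* Main.v *)
Require Import Defs.
From HB Require Import structures.
From mathcomp Require Import all_boot all_order all_algebra finmap.
From mathcomp Require Import all_classical all_reals all_analysis.
From mathcomp Require Import measurable_realfun ess_sup_inf ring lra zify.

Set Implicit Arguments.
Unset Strict Implicit.
Unset Printing Implicit Defensive.

Import Order.TTheory GRing.Theory Num.Theory.
Import numFieldNormedType.Exports.

Local Open Scope classical_set_scope.
Local Open Scope ring_scope.

(** Proof idea. For the couple (X0, X0 + X1), K(f, t; X0, X0 + X1) equals
    K(f, t; X0, X1) when t >= 1 and is at most t K(f, 1; X0, X1) when t <= 1.
    On [1, oo) the weights b and B agree, so the first two norms differ only in
    their suprema over (0, 1). Both of these are controlled by K(f, 1): one
    because b is bounded, the other because t B(t) is bounded near 0 by slow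
    variation. This is [Kspace_sum].

    The second identity is a statement about an arbitrary couple
    ([Kspace_Jspace]). Put phi = 1 / B, which grows from 0 to oo and is locally
    absolutely continuous, and psi = phi'. Then phi is the integral of psi
    ([ac_derivative]: Radon-Nikodym for the Stieltjes measure of phi, followed
    by Lebesgue differentiation), and A(s) = 1 / (s psi(s)) almost everywhere.
    So the J-norm is at most N when f is the integral of u(s) ds / s with
    J(u(s), s) <= N s psi(s), and the K-norm is at most N when
    K(f, t) <= N phi(t).

    From J to K ([represents_Kfun_le]): K(., t) is a seminorm, and
    K(x, t) <= min(1, t / s) J(x, s). Integrating along u gives
    K(f, t) <= N times the integral of min(1, t / s) psi(s). By slow variation
    phi grows no faster than a square root, and the integral is at most a
    constant times phi(t) ([integral_kernel]).

    From K to J ([exists_representation]): choose t_k with phi(t_k) = 2^k and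
    decompositions f = f0_k + f1_k that are almost optimal at t_k. The pieces
    f0_(k+1) - f0_k sum up to f. The classical choice puts this piece on the
    interval ]t_k, t_(k+1)], but here t_(k+1) / t_k is unbounded and
    s |f1_k|_1 <= s 2^k N / t_k would get out of control for s near t_(k+1).
    The piece is therefore moved one interval down: ]t_k, t_(k+1)] receives
    f0_(k+2) - f0_(k+1) = f1_(k+1) - f1_(k+2), whose norms are controlled at
    t_(k+1) and t_(k+2), hence on the whole interval. Since phi grows
    geometrically along the t_k, the shift costs only a constant factor. On
    each interval the piece is spread with density psi, which makes
    J(u(s), s) comparable with s psi(s); that f is the Bochner integral of the
    resulting function is [block_function_represents]. *)

(** * Monotone absolutely continuous functions are integrals *)

Section stieltjes_null_sets.
Variable R : realType.
Implicit Types (F : cumulative R R).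
Local Notation lambda := (@lebesgue_measure R).

Lemma stieltjes_ocitv F (x y : R) : x <= y ->
  lebesgue_stieltjes_measure F `]x, y]%classic = (F y - F x)%:E.
Proof.
move=> xy; rewrite /lebesgue_stieltjes_measure /measure_extension.
rewrite measurable_mu_extE/=; last exact: is_ocitv.
by rewrite wlength_itv_bnd.
Qed.

Lemma open_interval_endpoints (a c : R) (I : set R) : a <= c ->
  open I -> is_interval I -> I `<=` `]a, c[%classic ->
  exists p : R * R, [/\ a <= p.1, p.1 <= p.2, p.2 <= c & I = `]p.1, p.2[%classic].
Proof.
move=> ac oI itvI Iac.
have [->|/set0P[z Iz]] := eqVneq I set0.
  by exists (a, a); split => //=; rewrite set_itvoo0.
have lI : has_lbound I.
  by exists a => x /Iac/=; rewrite in_itv/= => /andP[/ltW].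
have uI : has_ubound I.
  by exists c => x /Iac/=; rewrite in_itv/= => /andP[_ /ltW].
have I0 : I !=set0 by exists z.
exists (inf I, sup I) => /=.
have IinfF : ~ I (inf I).
  move=> Ii; move: oI; rewrite openE => /(_ _ Ii)/= /nbhs_ballP[e /= e0] be.
  have /(be _) : ball (inf I) e (inf I - e / 2).
    rewrite /ball/= opprB addrC subrK gtr0_norm ?divr_gt0//.
    by rewrite ltr_pdivrMr// ltr_pMr// ltr1n.
  move=> /(ge_inf lI); rewrite lerBrDr gerDl leNgt => /negP; apply.
  by rewrite divr_gt0.
have IsupF : ~ I (sup I).
  move=> Ii; move: oI; rewrite openE => /(_ _ Ii)/= /nbhs_ballP[e /= e0] be.
  have /(be _) : ball (sup I) e (sup I + e / 2).
    rewrite /ball/= opprD addrA subrr add0r normrN gtr0_norm ?divr_gt0//.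
    by rewrite ltr_pdivrMr// ltr_pMr// ltr1n.
  move=> /(ub_le_sup uI); rewrite gerDl leNgt => /negP; apply.
  by rewrite divr_gt0.
split.
- apply: lb_le_inf => // x /Iac/=; rewrite in_itv/= => /andP[/ltW]//.
- by rewrite (le_trans (ge_inf lI Iz))// (ub_le_sup uI Iz).
- by apply: ge_sup => // x /Iac/=; rewrite in_itv/= => /andP[_ /ltW].
- rewrite {1}((is_intervalP I).1 itvI) /Rhull (asboolT lI) (asboolT uI).
  by rewrite (asboolF IinfF) (asboolF IsupF).
Qed.

(** Absolute continuity applies to finitely many disjoint intervals. A null set
    is covered by an open set of small measure, which is a countable disjoint
    union of intervals; its Stieltjes measure is the supremum of the sums over
    finitely many of them. *)
Lemma stieltjes_null_on F (a c : R) (N : set R) : a <= c ->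
  abs_continuous_on a c F -> measurable N -> N `<=` `]a, c[%classic ->
  lambda N = 0%E -> lebesgue_stieltjes_measure F N = 0%E.
Proof.
move=> ac acF mN Nac N0.
apply/eqP; rewrite eq_le measure_ge0 andbT.
apply/lee_addgt0Pr => e e0; rewrite add0e.
have [d d0 acFd] := acF e e0.
have Noo : (lambda N < +oo)%E by rewrite N0.
have [U [oU NU]] := lebesgue_regularity_outer mN Noo d0.
have mU : measurable U by exact: open_measurable.
move=> UNd.
have Ud : (lambda U < d%:E)%E.
  rewrite -(setDUK NU); apply: le_lt_trans UNd.
  apply: (@le_trans _ _ (lambda N + lambda (U `\` N))%E).
    by apply: measureU2 => //; exact: measurableD.
  by rewrite N0 add0e.
pose V := U `&` `]a, c[%classic.
have oV : open V by apply: openI => //; exact: interval_open.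
have mV : measurable V by exact: open_measurable.
have Vd : (lambda V < d%:E)%E.
  by apply: le_lt_trans Ud; apply: le_measure; rewrite ?inE//; apply: subIsetl.
pose I := open_disjoint_itv oV.
have IV n : I n `<=` V.
  by rewrite [X in _ `<=` X](open_disjoint_itv_bigcup oV) => x Ix; exists n.
have /choice[p pI] n : exists p : R * R,
    [/\ a <= p.1, p.1 <= p.2, p.2 <= c & I n = `]p.1, p.2[%classic].
  apply: open_interval_endpoints => //; first exact: open_disjoint_itv_open.
    exact: open_disjoint_itv_is_interval.
  by apply: subset_trans (IV n) _; apply: subIsetr.
have mI n : measurable (I n).
  by apply: open_measurable; exact: open_disjoint_itv_open.
have tI : trivIset setT I by exact: open_disjoint_itv_trivIset.
apply: (@le_trans _ _ (lebesgue_stieltjes_measure F V)).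
  by apply: le_measure; rewrite ?inE//; rewrite subsetI.
rewrite [V](open_disjoint_itv_bigcup oV) measure_semi_bigcup//; last first.
  by apply: bigcup_measurable => i _; exact: mI.
apply: lime_le; first by apply: is_cvg_nneseries.
apply: nearW => n /=; rewrite big_mkord.
have Fle i : (lebesgue_stieltjes_measure F (I i) <= (F (p i).2 - F (p i).1)%:E)%E.
  have [_ pp _ ->] := pI i; rewrite -stieltjes_ocitv//.
  apply: le_measure; rewrite ?inE//=.
  by apply: subset_itvl; rewrite bnd_simp.
apply: (@le_trans _ _ (\sum_(i < n) (F (p i).2 - F (p i).1)%:E)%E).
  by apply: lee_sum => i _; exact: Fle.
rewrite sumEFin lee_fin.
apply: le_trans (_ : \sum_(i < n) `|F (p i).2 - F (p i).1| <= _).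
  by apply: ler_sum => i _; exact: ler_norm.
apply/ltW/(acFd n (fun i => (p i).1) (fun i => (p i).2)).
- by move=> i; have [] := pI i.
- apply/trivIsetP => i j _ _ ij.
  have [_ _ _ <-] := pI i; have [_ _ _ <-] := pI j.
  by move/trivIsetP : tI; apply.
- rewrite -lte_fin; apply: le_lt_trans Vd.
  rewrite [V](open_disjoint_itv_bigcup oV) measure_semi_bigcup//; last first.
    by apply: bigcup_measurable => i _; exact: mI.
  apply: le_trans (nneseries_lim_ge n _) => //.
  rewrite big_mkord -sumEFin; apply: lee_sum => i _.
  have [_ pp _ Ii] := pI i.
  suff : (((p i).2 - (p i).1)%:E <= lambda (I i))%E by [].
  rewrite Ii lebesgue_measure_itv/= lte_fin.
  by case: ltgtP pp => // -> _; rewrite subrr.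
Qed.

End stieltjes_null_sets.

Section bounded_primitive.
Variable R : realType.
Local Notation lambda := (@lebesgue_measure R).

Lemma stieltjes_dominated (F : cumulative R R) :
  (forall x, x <= 0 -> F x = 0) -> locally_abs_continuous F ->
  lebesgue_stieltjes_measure F `<< lambda.
Proof.
move=> F0 acF; apply/null_content_dominatesP => /= N mN N0.
pose mu := lebesgue_stieltjes_measure F.
have NU : N `<=` (\bigcup_n `](- n%:R), 0]%classic) `|`
    \bigcup_n (N `&` `](n.+1%:R)^-1, n.+2%:R[%classic).
  move=> x Nx; have [x0|x0] := leP x 0; [left|right].
    exists (Num.bound `|x|) => //=; rewrite in_itv/= x0 andbT.
    rewrite ltrNl; apply: le_lt_trans (archi_boundP (normr_ge0 x)).
    by rewrite -normrN ler_norm.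
  have [n [xn ln]] : exists n : nat, x < n.+2%:R /\ (n.+1%:R)^-1 < x.
    (* The indices are shifted by 1 and 2 to make the endpoints positive and
       ordered for every n. *)
    exists (maxn (Num.bound x) (Num.bound x^-1)); split.
      apply: lt_le_trans (_ : (Num.bound x)%:R <= _).
        by apply: archi_boundP; exact: ltW.
      by rewrite ler_nat (leq_trans (leq_maxl _ (Num.bound x^-1)))// ltnW.
    rewrite invf_plt ?posrE//.
    apply: lt_le_trans (_ : (Num.bound x^-1)%:R <= _).
      by apply: archi_boundP; rewrite invr_ge0 ltW.
    by rewrite ler_nat (leq_trans (leq_maxr (Num.bound x) _)).
  by exists n => //; split => //=; rewrite in_itv/= ln xn.
apply: (@measure_negligible _ _ _ mu) => //; apply: negligibleS NU _.
apply: negligibleU; apply: negligible_bigcup => n.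
  apply/negligibleP => //=.
  by rewrite /mu stieltjes_ocitv ?oppr_le0// !F0// ?subrr// oppr_le0.
have mNn : measurable (N `&` `](n.+1%:R)^-1, n.+2%:R[%classic).
  exact: measurableI.
have nn : n.+1%:R^-1 <= n.+2%:R :> R.
  by rewrite (@le_trans _ _ 1) ?invf_le1 ?ler1n.
apply/negligibleP => //; apply: (stieltjes_null_on (a := n.+1%:R^-1) (c := n.+2%:R)) => //.
  by apply: acF => //; rewrite invr_gt0.
apply/eqP; rewrite eq_le measure_ge0 andbT.
apply: (@le_trans _ _ (lambda N)); last by rewrite N0.
by apply: le_measure; rewrite ?inE//.
Qed.

Lemma near_eq_derive1 (f g : R -> R) (x : R) : (\near x, f x = g x) ->
  derivable f x 1 -> derivable g x 1 /\ derive1 g x = derive1 f x.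
Proof.
move=> fg df; split; first exact: near_eq_derivable df.
by rewrite !derive1E; apply/esym/near_eq_derive.
Qed.

(** A bounded [f] has a finite Stieltjes measure, to which the Radon-Nikodym
    theorem applies; Lebesgue differentiation identifies the density with the
    derivative. *)
Lemma bounded_ac_derivative (f : R -> R) :
  {homo f : x y / x <= y} -> continuous f -> (forall x, x <= 0 -> f x = 0) ->
  f x @[x --> +oo] --> (1 : R) -> locally_abs_continuous f ->
  exists theta : R -> R,
    [/\ measurable_fun setT theta, forall x, 0 <= theta x,
        forall x y, x <= y ->
          (\int[lambda]_(t in `]x, y]) (theta t)%:E = (f y - f x)%:E)%E &
        {ae lambda, forall x, 0 < x ->
           derivable f x 1 /\ derive1 f x = theta x}].
Proof.
move=> ndf cf f0 f1 acf.
have fNy : f x @[x --> -oo] --> (0 : R).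
  apply: cvg_near_cst; near=> x; apply: f0; near: x.
  exact: nbhs_ninfty_le.
have rcf : forall x, f%function @ at_right x --> f%function x.
  exact: right_continuousW.
pose F : cumulativeBounded (0:R) (1:R) := HB.pack f
  (isCumulative.Build R _ R f ndf rcf) (isCumulativeBounded.Build R 0 1 f fNy f1).
have dom : lebesgue_stieltjes_measure F `<< lambda by exact: stieltjes_dominated.
pose g := Radon_Nikodym_SigmaFinite.f (lebesgue_stieltjes_measure F) lambda.
have g0 x : (0 <= g x)%E by exact: Radon_Nikodym_SigmaFinite.f_ge0.
have gfin x : g x \is a fin_num by exact: Radon_Nikodym_SigmaFinite.f_fin_num.
have intg : lambda.-integrable setT g by exact: Radon_Nikodym_SigmaFinite.f_integrable.
pose theta x := fine (g x).
have gE : g = EFin \o theta by apply/funext => x /=; rewrite fineK.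
have mtheta : measurable_fun setT theta.
  by apply/measurable_EFinP; rewrite -gE; exact: measurable_int intg.
have itheta x y : x <= y ->
    (\int[lambda]_(t in `]x, y]) (theta t)%:E = (f y - f x)%:E)%E.
  move=> xy; rewrite -(stieltjes_ocitv F xy) (Radon_Nikodym_SigmaFinite.f_integral dom)//.
  by apply: eq_integral => t _; rewrite -/g gE.
exists theta; split => //; first by move=> x; rewrite fine_ge0.
have inttheta : lambda.-integrable setT (EFin \o theta) by rewrite -gE.
have inty y : lambda.-integrable `]0, y] (EFin \o theta).
  by apply: integrableS inttheta.
have loc : locally_integrable [set: R] theta.
  by apply: open_integrable_locally => //; exact: openT.
have ftc := FTC1 inty loc.
move: ftc; apply: filterS; first exact: (ae_filter_ringOfSetsType lambda).
move=> x /= H x0.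
have {H} [|] := H; first by rewrite lte_fin.
move=> dF <-; apply: near_eq_derive1 => //.
near=> y; rewrite /Rintegral itheta/= ?(f0 0) ?subr0//.
by apply/ltW; near: y; exact: lt_nbhsr.
Unshelve. all: by end_near. Qed.
End bounded_primitive.

Section primitive.
Variable R : realType.
Local Notation lambda := (@lebesgue_measure R).

(** Serves to write the derivative as a Borel function: the
    left-hand side is an upper limit of functions that are continuous in [x]
    when [f] is. *)
Lemma derive1_limn (f : R -> R) (x : R) : derivable f x 1 ->
  limn_esup (fun k => ((f (k.+1%:R^-1 + x) - f x) * k.+1%:R)%:E) =
  (derive1 f x)%:E.
Proof.
move=> df.
have cf : (fun h : R => h^-1 *: (f (h + x) - f x)) @ 0^' --> derive1 f x.
  suff : cvg ((fun h : R => h^-1 *: (f (h + x) - f x)) @ 0^') by [].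
  move: df; rewrite /derivable /=; set g := (g in cvg (g @ _) -> _).
  by rewrite (_ : g = (fun h : R => h^-1 *: (f (h + x) - f x)))//;
     apply/funext => h; rewrite /g/= [h%:A]mulr1.
have Hc := (cvg_at_rightP _ _ _).1 (cvg_dnbhs_at_right cf).
have cu : (fun k : nat => (k.+1%:R^-1 : R)^-1 *: (f (k.+1%:R^-1 + x) - f x)) @ \oo
    --> derive1 f x.
  by apply: (Hc (fun k => k.+1%:R^-1)); split; [move=> n; rewrite invr_gt0|exact: cvg_harmonic].
have {}cu : ((f (k.+1%:R^-1 + x) - f x) * k.+1%:R)%:E @[k --> \oo] -->
    (derive1 f x)%:E.
  apply: cvg_EFin; first by apply: nearW.
  apply: cvg_trans cu; apply: near_eq_cvg; apply: nearW => k /=.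
  by rewrite invrK mulrC.
rewrite is_cvg_limn_esupE; first exact/cvg_lim.
by apply/cvg_ex; eexists; exact: cu.
Qed.

(** The unbounded case follows by truncation. The truncations min(phi, n) give
    densities that agree almost everywhere on the sets where phi < n; the upper
    limit of difference quotients is one Borel function that coincides with all
    of them. *)
Lemma ac_derivative (phi : R -> R) :
  {homo phi : x y / x <= y} -> continuous phi -> (forall x, x <= 0 -> phi x = 0) ->
  phi x @[x --> +oo] --> +oo -> locally_abs_continuous phi ->
  exists psi : R -> R,
    [/\ measurable_fun setT psi, forall x, 0 <= psi x,
        forall x y, 0 <= x -> x <= y ->
          (\int[lambda]_(t in `]x, y]) (psi t)%:E = (phi y - phi x)%:E)%E &
        {ae lambda, forall x, 0 < x ->
           derivable phi x 1 /\ derive1 phi x = psi x}].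
Proof.
move=> ndphi cphi phi0 phioo acphi.
have phi_ge0 x : 0 <= phi x.
  by have [/phi0->//|/ltW/ndphi] := leP x 0; rewrite phi0.
(* Truncation at height n + 1, normalized to have limit 1 at infinity. *)
pose f (n : nat) (x : R) : R := n.+1%:R^-1 * Num.min (phi x) n.+1%:R.
have minc (a b k : R) : `|Num.min a k - Num.min b k| <= `|a - b|.
  rewrite !minEle; case: (leP a k); case: (leP b k) => // bk ak.
  - rewrite ler0_norm ?subr_le0// ler0_norm ?subr_le0; last by lra.
    by lra.
  - rewrite ger0_norm ?subr_ge0// ger0_norm ?subr_ge0; last by lra.
    by lra.
  - by rewrite subrr normr0.
have ninv n : 0 <= (n.+1%:R^-1 : R) <= 1.
  apply/andP; split; first by rewrite invr_ge0.
  by rewrite -[leRHS]invr1 lef_pV2 ?posrE// ler1n.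
have /choice[theta thetaP] n : exists theta : R -> R,
    [/\ measurable_fun setT theta, forall x, 0 <= theta x,
        forall x y, x <= y ->
          (\int[lambda]_(t in `]x, y]) (theta t)%:E = (f n y - f n x)%:E)%E &
        {ae lambda, forall x, 0 < x ->
           derivable (f n) x 1 /\ derive1 (f n) x = theta x}].
  apply: bounded_ac_derivative.
  - move=> x y xy; rewrite /f ler_pM2l ?invr_gt0//.
    by rewrite le_min !ge_min ndphi//= lexx orbT.
  - move=> x; rewrite /f; apply: cvgMl_tmp.
    by apply: (@continuous_min R R phi (cst n.+1%:R)); [exact: cphi|exact: cst_continuous].
  - by move=> x x0; rewrite /f phi0// minEle ler0n mulr0.
  - apply: cvg_near_cst; near=> x; rewrite /f.
    have : n.+1%:R <= phi x by near: x; move/cvgryPge : phioo; exact.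
    by move=> nx; rewrite minEle leNgt; case: ltgtP nx => //= [_ _|<- _]; rewrite mulVf.
  - move=> a c a0 ac e e0; have [d d0 H] := acphi a c a0 ac e e0.
    exists d => // m x y xy txy sxy; apply: le_lt_trans (H m x y xy txy sxy).
    apply: ler_sum => i _; rewrite /f -mulrBr normrM.
    apply: (@le_trans _ _ (1 * `|Num.min (phi (y i)) n.+1%:R - Num.min (phi (x i)) n.+1%:R|)).
      apply: ler_wpM2r => //; rewrite ger0_norm; last by case/andP: (ninv n).
      by case/andP: (ninv n).
    by rewrite mul1r; exact: minc.
(* The maximum with 0 makes psi nonnegative without any further argument. *)
pose psi x := Num.max 0 (fine
  (limn_esup (fun k => ((phi (k.+1%:R^-1 + x) - phi x) * k.+1%:R)%:E))).
have mphi : measurable_fun setT phi by exact: continuous_measurable_fun.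
have mpsi : measurable_fun setT psi.
  apply: measurable_maxr => //; apply: (@measurableT_comp _ _ _ _ _ _ fine) => //.
  apply: measurable_fun_limn_esup => k; apply/measurable_EFinP.
  apply: measurable_funM => //; apply: measurable_funB => //.
  by apply: (@measurableT_comp _ _ _ _ _ _ phi) => //; exact: measurable_funD.
have key : {ae lambda, forall x, 0 < x -> derivable phi x 1 /\
    forall n, phi x < n.+1%:R -> derive1 phi x = n.+1%:R * theta n x}.
  have : {ae lambda, forall x n, 0 < x ->
      derivable (f n) x 1 /\ derive1 (f n) x = theta n x}.
    by apply: ae_foralln => n; case: (thetaP n).
  apply: filterS; first exact: (ae_filter_ringOfSetsType lambda).
  move=> x H x0.
  have K n : phi x < n.+1%:R ->
      derivable phi x 1 /\ derive1 phi x = n.+1%:R * theta n x.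
    move=> xn; have [dn <-] := H n x0.
    have [|d1 d2] := @near_eq_derive1 R (n.+1%:R \*: f n) phi x _ (derivableZ dn).
      have := cphi x; move=> /(_ _ (lt_nbhsl xn)) => cx.
      near=> t; rewrite /f /= minEle ltW; last by near: t; exact: cx.
      by rewrite /GRing.scale/= mulrA mulfV// mul1r.
    by split => //; rewrite d2 !derive1E deriveZ.
  split.
    by case: (K (Num.bound (phi x))) => //; apply: lt_trans (archi_boundP (phi_ge0 x)) _;
      rewrite ltr_nat.
  by move=> n /K[].
exists psi; split => //.
- by move=> x; rewrite /psi le_max lexx.
- move=> x y x0 xy.
  pose n := Num.bound (phi y).
  have yn : phi y < n.+1%:R.
    by apply: lt_trans (archi_boundP (phi_ge0 y)) _; rewrite ltr_nat.
  have [mt t0 it _] := thetaP n.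
  transitivity (\int[lambda]_(t in `]x, y]) (n.+1%:R * theta n t)%:E)%E.
    apply: ae_eq_integral => //.
    + by apply/measurable_EFinP; exact: measurable_funTS.
    + by apply/measurable_EFinP; apply: measurable_funTS; exact: measurable_funM.
    + move: key; apply: filterS; first exact: (ae_filter_ringOfSetsType lambda).
      move=> t H; rewrite /= in_itv/= => /andP[xt ty].
      have [dt /(_ n)] := H (le_lt_trans x0 xt).
      move=> /(_ (le_lt_trans (ndphi _ _ ty) yn)) e.
      by rewrite /psi derive1_limn//= e max_r// mulr_ge0.
  under eq_integral do rewrite EFinM.
  rewrite ge0_integralZl//.
  + rewrite it// -EFinM; congr EFin; rewrite /f -mulrBr mulrA mulfV// mul1r.
    rewrite !minEle ltW// ltW//; apply: le_lt_trans yn; exact: ndphi.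
  + by apply/measurable_EFinP; exact: measurable_funTS.
  + by move=> t _; rewrite lee_fin.
- move: key; apply: filterS; first exact: (ae_filter_ringOfSetsType lambda).
  move=> x H x0; have [dx e] := H x0; split => //.
  rewrite /psi derive1_limn//= max_r//.
  rewrite (e (Num.bound (phi x))); first by rewrite mulr_ge0//; case: (thetaP (Num.bound (phi x))).
  by apply: lt_trans (archi_boundP (phi_ge0 x)) _; rewrite ltr_nat.
Unshelve. all: by end_near. Qed.
End primitive.

(** * Monotone weights and their reciprocals *)

Section monotone_limits.
Variable R : realType.
Implicit Type f : R -> R.

Lemma strictly_decreasing_nonincreasing f :
  strictly_decreasing_pos f -> nonincreasing_pos f.
Proof.
move=> df x y x0; rewrite le_eqVlt => /predU1P[->//|xy].
exact/ltW/df.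
Qed.

Lemma at_zero_sup f : nonincreasing_pos f ->
  at_zero f = ereal_sup [set (f t)%:E | t in `]0, +oo[%classic].
Proof.
move=> df; apply/cvg_lim => //.
have := @nonincreasing_at_right_cvge R (EFin \o f) 0 +oo%O isT.
apply => x y; rewrite !in_itv/= !andbT => x0 y0 xy.
by rewrite lee_fin; exact: df.
Qed.

Lemma at_zero_ltey f : nonincreasing_pos f -> (at_zero f < +oo)%E ->
  exists2 M, 0 < M & forall t, 0 < t -> f t <= M.
Proof.
move=> df; rewrite at_zero_sup// => foo.
set S := [set _ | _ in _] in foo.
have fle t : 0 < t -> ((f t)%:E <= ereal_sup S)%E.
  by move=> t0; apply: ereal_sup_ubound; exists t => //=; rewrite in_itv/= t0.
have : ereal_sup S \is a fin_num.
  by rewrite fin_numElt foo andbT (lt_le_trans _ (fle 1 _))// ltNyr.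
move=> /fineK Sfin; exists (Num.max 1 (fine (ereal_sup S))).
  by rewrite lt_max ltr01.
by move=> t t0; rewrite le_max -[X in _ || X]lee_fin Sfin fle// orbT.
Qed.

Lemma at_zero_eqy f : nonincreasing_pos f -> at_zero f = +oo%E ->
  forall M, exists2 d, 0 < d & forall t, 0 < t -> t <= d -> M <= f t.
Proof.
move=> df; rewrite at_zero_sup// => foo M.
set S := [set _ | _ in _] in foo.
have SM : (M%:E < ereal_sup S)%E by rewrite foo ltry.
have [_ [d /= d0 <-]] := ereal_sup_gt SM.
rewrite lte_fin => Md; move: d0; rewrite in_itv/= andbT => d0.
by exists d => // t t0 td; apply/ltW/(lt_le_trans Md)/df.
Qed.

Lemma at_infty_eq0 f : nonincreasing_pos f -> at_infty f = 0%E ->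
  forall e, 0 < e -> exists2 N, 0 < N & forall t, N <= t -> f t <= e.
Proof.
move=> df f0 e e0.
(* Monotone on the whole line, and equal to f near infinity. *)
pose g (x : R) := (f (Num.max x 1))%:E.
have dg (x y : R) : x <= y -> (g y <= g x)%E.
  move=> xy; rewrite lee_fin; apply: df.
    by rewrite lt_max ltr01 orbT.
  by rewrite ge_max !le_max xy lexx orbT.
have : at_infty f = ereal_inf (range g).
  apply/cvg_lim => //; apply: cvg_trans (nonincreasing_cvge dg).
  apply: near_eq_cvg; near=> x; rewrite /g max_l//.
rewrite f0 => /esym g0.
have /ereal_inf_lt[_ [N _ <-]] : (ereal_inf (range g) < e%:E)%E by rewrite g0 lte_fin.
rewrite /g lte_fin => Ne; exists (Num.max N 1); first by rewrite lt_max ltr01 orbT.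
move=> t Nt; apply/ltW/(le_lt_trans _ Ne)/df => //.
by rewrite lt_max ltr01 orbT.
Unshelve. all: by end_near. Qed.

End monotone_limits.

(** The value 0 on the nonpositive reals makes this a continuous nondecreasing
    function on the whole line when [B] decreases from oo, so that it has a
    Stieltjes measure. *)
Definition reciprocal_pos (R : realType) (B : R -> R) (x : R) : R :=
  if 0 < x then (B x)^-1 else 0.

Section reciprocal.
Variables (R : realType) (B : R -> R).
Hypothesis B_pos : forall t, 0 < t -> 0 < B t.
Hypothesis B_dec : nonincreasing_pos B.
Hypothesis B_ac : locally_abs_continuous B.
Hypothesis B_zero : forall M, exists2 d, 0 < d & forall t, 0 < t -> t <= d -> M <= B t.
Hypothesis B_infty :
  forall e, 0 < e -> exists2 N, 0 < N & forall t, N <= t -> B t <= e.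
Local Notation phi := (reciprocal_pos B).

Lemma reciprocal_posE x : 0 < x -> phi x = (B x)^-1.
Proof. by rewrite /reciprocal_pos => ->. Qed.

Lemma reciprocal_pos0 x : x <= 0 -> phi x = 0.
Proof. by rewrite /reciprocal_pos ltNge => ->. Qed.

Lemma reciprocal_gt0 x : 0 < x -> 0 < phi x.
Proof. by move=> x0; rewrite reciprocal_posE// invr_gt0 B_pos. Qed.

Lemma reciprocal_ge0 x : 0 <= phi x.
Proof. by case: (leP x 0) => [/reciprocal_pos0->//|/reciprocal_gt0/ltW]. Qed.

Lemma reciprocal_nd : {homo phi : x y / x <= y}.
Proof.
move=> x y xy; have [/reciprocal_pos0->|x0] := leP x 0; first exact: reciprocal_ge0.
have y0 : 0 < y by exact: lt_le_trans xy.
by rewrite !reciprocal_posE// lef_pV2 ?posrE ?B_pos// B_dec.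
Qed.

Lemma reciprocal_ac : locally_abs_continuous phi.
Proof.
move=> a c a0 ac e e0.
have c0 : 0 < c by exact: lt_le_trans ac.
have [d d0 H] := B_ac a0 ac (mulr_gt0 e0 (exprn_gt0 2 (B_pos c0))).
exists d => // n x y xy txy sxy.
have {}H := H n x y xy txy sxy.
rewrite -(ltr_pM2r (exprn_gt0 2 (B_pos c0))); apply: le_lt_trans H.
rewrite mulr_suml; apply: ler_sum => i _.
have [ax xy' yc] := xy i.
have x0 : 0 < x i by exact: lt_le_trans ax.
have y0 : 0 < y i by exact: lt_le_trans xy'.
have Bx := B_pos x0; have By := B_pos y0; have Bc := B_pos c0.
have Bxc : B c <= B (x i) by apply: B_dec => //; exact: le_trans xy' yc.
have Byc : B c <= B (y i) by exact: B_dec.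
rewrite !reciprocal_posE//.
have -> : (B (y i))^-1 - (B (x i))^-1 = (B (x i) - B (y i)) * (B (x i) * B (y i))^-1.
  by field; rewrite !gt_eqF.
rewrite normrM distrC -mulrA -[leRHS]mulr1 ler_wpM2l//.
have Bxy : 0 < B (x i) * B (y i) by exact: mulr_gt0.
rewrite gtr0_norm ?invr_gt0// [leLHS]mulrC ler_pdivrMr//.
by rewrite mul1r expr2 ler_pM// ltW.
Qed.

(** Absolute continuity for a single interval. *)
Lemma locally_ac_cvg f (x : R) : 0 < x -> locally_abs_continuous f ->
  f y @[y --> x] --> (f x : R).
Proof.
move=> x0 acf; apply/cvgrPdist_lt => e e0.
have x2 : 0 < x / 2 by rewrite divr_gt0.
have [d d0 H] := acf (x / 2) (x + 1) x2 ltac:(lra) e e0.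
near=> y.
have yx : `|x - y| < d by near: y; exact: cvgr_dist_lt.
have yl : x / 2 < y by near: y; apply: lt_nbhsr; lra.
have yu : y < x + 1 by near: y; apply: lt_nbhsl; lra.
have H1 (u v : R) : x / 2 <= u -> u <= v -> v <= x + 1 -> v - u < d ->
    `|f v - f u| < e.
  move=> xu uv vx uvd.
  have := H 1%N (fun=> u) (fun=> v) _ _ _; rewrite !big_ord1; apply => //.
  by apply/trivIsetP => i j _ _; rewrite !ord1 eqxx.
have [xy|yx'] := leP x y.
  rewrite distrC; apply: H1 => //; [lra|exact: ltW|].
  by rewrite distrC ger0_norm ?subr_ge0// in yx.
by apply: H1; [exact: ltW|exact: ltW|lra|rewrite gtr0_norm ?subr_gt0// in yx].
Unshelve. all: by end_near. Qed.

Lemma reciprocal_continuous : continuous phi.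
Proof.
move=> x; have [x0|x0|->] := ltgtP x 0; last 2 first.
- exact: locally_ac_cvg reciprocal_ac.
- apply/cvgrPdist_le => e e0; rewrite reciprocal_pos0//.
  have [d d0 H] := B_zero e^-1.
  near=> y; rewrite sub0r normrN ger0_norm ?reciprocal_ge0//.
  have [y0|y0] := leP y 0; first by rewrite reciprocal_pos0// ltW.
  rewrite reciprocal_posE// -[leRHS]invrK lef_pV2 ?posrE ?invr_gt0 ?B_pos//.
  by apply: H => //; apply/ltW; near: y; exact: lt_nbhsl.
- rewrite /continuous_at reciprocal_pos0 ?ltW//.
  apply: cvg_near_cst; near=> y; apply: reciprocal_pos0; apply/ltW; near: y.
  exact: lt_nbhsl.
Unshelve. all: by end_near. Qed.

Lemma reciprocal_cvgy : phi x @[x --> +oo] --> +oo.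
Proof.
apply/cvgryPge => M.
have M0 : 0 < Num.max M 1 by rewrite lt_max ltr01 orbT.
have [|N N0 H] := B_infty (e := (Num.max M 1)^-1); first by rewrite invr_gt0.
near=> x.
have Nx : N <= x by near: x; apply: nbhs_pinfty_ge; rewrite num_real.
have x0 : 0 < x by exact: lt_le_trans Nx.
apply: (@le_trans _ _ (Num.max M 1)); first by rewrite le_max lexx.
rewrite reciprocal_posE// -[leLHS]invrK lef_pV2 ?posrE ?invr_gt0 ?B_pos//.
exact: H.
Unshelve. all: by end_near. Qed.

Lemma reciprocal_range y : 0 < y -> exists2 t, 0 < t & phi t = y.
Proof.
move=> y0.
have [d d0 Hd] := B_zero y^-1.
have [|N N0 HN] := B_infty (e := y^-1); first by rewrite invr_gt0.
have dy : phi d <= y.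
  by rewrite reciprocal_posE// -[leRHS]invrK lef_pV2 ?posrE ?invr_gt0 ?B_pos// Hd.
have Ny : y <= phi N.
  by rewrite reciprocal_posE// -[leLHS]invrK lef_pV2 ?posrE ?invr_gt0 ?B_pos// HN.
have [dN|Nd] := leP d N.
  have [|c cdN <-] := @IVT R phi d N y dN (continuous_subspaceT reciprocal_continuous).
    by rewrite ge_min le_max dy Ny orbT.
  by exists c => //; apply: lt_le_trans d0 _; rewrite (itvP cdN).
exists d => //; apply/eqP; rewrite eq_le dy (le_trans Ny)//.
exact/reciprocal_nd/ltW.
Qed.

End reciprocal.

(** * Integrating the kernel min(1, t / s) *)

(** The setting of all the estimates below: [phi] is the reciprocal of the
    weight and [psi] its derivative. *)
Record increasing_primitive (R : realType) (phi psi : R -> R) : Prop := {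
  primitive_nd : {homo phi : x y / x <= y} ;
  primitive_le0 : forall x, x <= 0 -> phi x = 0 ;
  primitive_gt0 : forall x, 0 < x -> 0 < phi x ;
  density_measurable : measurable_fun setT psi ;
  density_ge0 : forall x, 0 <= psi x ;
  integral_density : forall x y, 0 <= x -> x <= y ->
    (\int[@lebesgue_measure R]_(t in `]x, y]) (psi t)%:E = (phi y - phi x)%:E)%E }.

(** Slow variation of a weight bounds the growth of its reciprocal by every
    positive power. The exponent one half makes the geometric series below
    explicit. *)
Definition sqrt_growth (R : realType) (C : R) (phi : R -> R) : Prop :=
  forall r s, 0 < r -> r <= s -> phi s <= C * Num.sqrt (s / r) * phi r.

Section kernel.
Variables (R : realType) (phi psi : R -> R) (C : R).
Hypothesis P : increasing_primitive phi psi.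
Hypothesis G : sqrt_growth C phi.
Local Notation lambda := (@lebesgue_measure R).

Let psi0 := density_ge0 P.
Let mpsi := density_measurable P.

Lemma sqrt_growth_ge1 : 1 <= C.
Proof.
have := @G 1 1 ltr01 (lexx _).
rewrite divr1 sqrtr1 mulr1 -{1}(mul1r (phi 1)) ler_pM2r//.
exact: primitive_gt0 P _ ltr01.
Qed.

Lemma measurable_inv_pos : measurable_fun (`]0, +oo[%classic : set R) (fun s : R => s^-1).
Proof.
apply: open_continuous_measurable_fun; first exact: interval_open.
move=> s; rewrite inE/= in_itv/= andbT => s0.
by apply: inv_continuous; rewrite gt_eqF.
Qed.

Lemma measurable_tail (t : R) :
  measurable_fun (`]0, +oo[%classic : set R) (fun s => t / s * psi s).
Proof.
apply: measurable_funM; last exact: measurable_funTS.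
by apply: measurable_funM => //; exact: measurable_inv_pos.
Qed.

Lemma measurable_kernel (t : R) :
  measurable_fun (`]0, +oo[%classic : set R) (fun s => Num.min 1 (t / s) * psi s).
Proof.
apply: measurable_funM; last exact: measurable_funTS.
apply: measurable_minr => //.
by apply: measurable_funM => //; exact: measurable_inv_pos.
Qed.

(** On each interval ]4^k t, 4^(k+1) t] the factor t / s is at most 4^-k while
    [phi] grows by at most 2^(k+1) C from t; the pieces form a geometric
    series. *)
Lemma integral_dyadic_tail (t : R) n : 0 < t ->
  (\int[lambda]_(s in `]t, (4 ^+ n * t)%R]) (t / s * psi s)%:E <=
   (4 * C * phi t * (1 - 2 ^- n))%:E)%E.
Proof.
move=> t0.
have C1 := sqrt_growth_ge1.
have phit := primitive_gt0 P t0.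
have mts (x y : R) : 0 <= x -> measurable_fun `]x, y]%classic (fun s => (t / s * psi s)%:E).
  move=> x0; apply/measurable_EFinP; apply: measurable_funS (measurable_tail t) => //.
  by move=> s /=; rewrite !in_itv/= andbT => /andP[/(le_lt_trans x0)].
have kge0 (x y : R) : 0 <= x -> forall s, `]x, y]%classic s -> (0 <= (t / s * psi s)%:E)%E.
  move=> x0 s /=; rewrite in_itv/= => /andP[/(le_lt_trans x0) s0 _].
  by rewrite lee_fin mulr_ge0// divr_ge0// ltW.
elim: n => [|n IH].
  by rewrite expr0 mul1r set_itvoc0 integral_set0 expr0 invr1 subrr mulr0.
set a := 4 ^+ n * t in IH *.
have a0 : 0 < a by rewrite mulr_gt0// exprn_gt0.
have ta : t <= a by apply: ler_peMl; [exact: ltW|rewrite exprn_ege1// ler1n].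
have -> : 4 ^+ n.+1 * t = 4 * a by rewrite exprS mulrA.
have a4 : a <= 4 * a by lra.
have U : `]t, a]%classic `|` `]a, (4 * a)%R]%classic = `]t, (4 * a)%R]%classic :> set R.
  by rewrite -itv_bndbnd_setU ?bnd_simp// ltW.
rewrite -U ge0_integral_setU//; last 3 first.
- by rewrite U; apply: mts; exact: ltW.
- by rewrite U; apply: kge0; exact: ltW.
- apply/disj_setPS => s [] /=; rewrite !in_itv/= => /andP[_ sa] /andP[].
  by rewrite ltNge sa.
have H : (\int[lambda]_(s in `]a, (4 * a)%R]) (t / s * psi s)%:E <=
    (2 * C * phi t * 2 ^- n)%:E)%E.
  apply: (@le_trans _ _ (\int[lambda]_(s in `]a, (4 * a)%R]) ((4 ^- n)%:E * (psi s)%:E))%E).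
    apply: ge0_le_integral => //=.
    - by apply: kge0; exact: ltW.
    - by apply: mts; exact: ltW.
    - by apply: measurable_funeM; apply/measurable_EFinP; exact: measurable_funTS.
    - move=> s; rewrite in_itv/= => /andP[sa _]; rewrite lee_fin ler_wpM2r//.
      have s0 : 0 < s by exact: lt_trans sa.
      rewrite ler_pdivrMr// -ler_pdivrMl ?invr_gt0 ?exprn_gt0// invrK.
      exact: ltW.
  rewrite ge0_integralZl//=; last 2 first.
  - by apply/measurable_EFinP; exact: measurable_funTS.
  - by move=> s _; rewrite lee_fin.
  rewrite (integral_density P (ltW a0) a4) -EFinM lee_fin.
  apply: (@le_trans _ _ (4 ^- n * phi (4 * a))).
    by rewrite ler_wpM2l ?invr_ge0 ?exprn_ge0// gerBl ltW// (primitive_gt0 P).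
  apply: (@le_trans _ _ (4 ^- n * (C * Num.sqrt (4 * a / t) * phi t))).
    rewrite ler_wpM2l ?invr_ge0 ?exprn_ge0//; apply: G => //.
    exact: le_trans ta _.
  have -> : 4 * a / t = (2 ^+ n.+1) ^+ 2.
    rewrite /a mulrA -exprS mulfK ?gt_eqF// -exprM mulnC exprM.
    by congr (_ ^+ _); rewrite -natrX.
  rewrite sqrtr_sqr ger0_norm ?exprn_ge0//.
  have -> : (4 : R) ^- n = 2 ^- n * 2 ^- n.
    by rewrite -invfM -exprMn; congr (_ ^- _); ring.
  rewrite exprS.
  have -> // : 2 ^- n * 2 ^- n * (C * (2 * 2 ^+ n) * phi t) = 2 * C * phi t * 2 ^- n.
  by field; rewrite expf_neq0.
apply: le_trans (leeD IH H) _; rewrite -EFinD lee_fin exprS invfM.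
by have -> : 4 * C * phi t * (1 - 2 ^- n) + 2 * C * phi t * 2 ^- n =
  4 * C * phi t * (1 - 2^-1 * 2 ^- n) by field; rewrite expf_neq0.
Qed.

Lemma integral_kernel (t : R) : 0 < t ->
  (\int[lambda]_(s in `]0%R, +oo[) (Num.min 1 (t / s) * psi s)%:E <=
   (5 * C * phi t)%:E)%E.
Proof.
move=> t0.
have C1 := sqrt_growth_ge1.
have phit := primitive_gt0 P t0.
have kge0 s : 0 < s -> 0 <= Num.min 1 (t / s) * psi s.
  by move=> s0; rewrite mulr_ge0// le_min ler01 divr_ge0// ltW.
have U : `]0, t]%classic `|` `]t, +oo[%classic = `]0, +oo[%classic :> set R.
  by rewrite -itv_bndbnd_setU ?bnd_simp// ltW.
rewrite -U ge0_integral_setU//; last 3 first.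
- by rewrite U; apply/measurable_EFinP; exact: measurable_kernel.
- by rewrite U => s /=; rewrite in_itv/= andbT lee_fin; exact: kge0.
- apply/disj_setPS => s [] /=; rewrite !in_itv/= andbT => /andP[_ sa].
  by rewrite ltNge sa.
have -> : 5 * C * phi t = C * phi t + 4 * C * phi t by ring.
rewrite EFinD; apply: leeD.
  apply: (@le_trans _ _ (\int[lambda]_(s in `]0%R, t]) (psi s)%:E)%E).
    apply: ge0_le_integral => //=.
    - by move=> s; rewrite in_itv/= lee_fin => /andP[/kge0].
    - apply/measurable_EFinP; apply: measurable_funS (measurable_kernel t) => //.
      by move=> s /=; rewrite !in_itv/= andbT => /andP[].
    - by apply/measurable_EFinP; exact: measurable_funTS.
    - by move=> s _; rewrite lee_fin ler_piMl// ge_min lexx.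
  rewrite (integral_density P (lexx 0) (ltW t0)) lee_fin (primitive_le0 P (lexx 0)) subr0.
  by rewrite ler_peMl// ltW.
have tail : `]t, +oo[%classic = \bigcup_n `]t, (4 ^+ n * t)%R]%classic :> set R.
  apply/seteqP; split => [s /=|s [n _] /=].
    rewrite in_itv/= andbT => ts.
    exists (Num.bound (s / t)) => //=; rewrite in_itv/= ts/= -ler_pdivrMr//.
    apply/ltW/(lt_le_trans (archi_boundP _)).
      by rewrite divr_ge0// ltW// (lt_trans t0).
    by rewrite -natrX ler_nat; apply: ltnW; exact: ltn_expl.
  by rewrite !in_itv/= andbT => /andP[].
have nd : nondecreasing_seq (fun n => `]t, (4 ^+ n * t)%R]%classic : set R).
  move=> m n mn; apply/subsetPset/subset_itvl; rewrite bnd_simp ler_pM2r//.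
  by rewrite ler_eXn2l// ltr1n.
have sub n : (`]t, (4 ^+ n * t)%R]%classic : set R) `<=` `]0, +oo[%classic.
  by move=> s /=; rewrite !in_itv/= andbT => /andP[/(lt_trans t0)].
have nu n : measurable_fun (`]t, (4 ^+ n * t)%R]%classic : set R)
    (fun s => (Num.min 1 (t / s) * psi s)%:E).
  by apply/measurable_EFinP; apply: measurable_funS (measurable_kernel t).
have n0 n (s : R) : `]t, (4 ^+ n * t)%R]%classic s -> (0 <= (Num.min 1 (t / s) * psi s)%:E)%E.
  by move=> /sub/=; rewrite in_itv/= andbT lee_fin; exact: kge0.
have := ge0_nondecreasing_set_cvg_integral (mu := lambda) nd (fun n => measurable_itv _) nu n0.
rewrite -tail => cv; rewrite -(cvg_lim _ cv)//.
apply: lime_le; first by apply/cvg_ex; eexists; exact: cv.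
apply: nearW => n.
apply: (@le_trans _ _ (4 * C * phi t * (1 - 2 ^- n))%:E); last first.
  rewrite lee_fin ger_pMr; first by rewrite gerBl invr_ge0 exprn_ge0.
  by rewrite !mulr_gt0//; lra.
apply: le_trans (integral_dyadic_tail n t0).
apply: ge0_le_integral => //=.
- by move=> s; exact: n0.
- by apply/measurable_EFinP; apply: measurable_funS (measurable_kernel t).
- by apply/measurable_EFinP; apply: measurable_funS (measurable_tail t).
- by move=> s /sub _; rewrite lee_fin ler_wpM2r// ge_min lexx orbT.
Qed.
End kernel.

(** * Extended seminorms and the K-functional *)

Section ereal_bounds.
Variable R : realType.
Implicit Types x y : \bar R.

(** Infima are compared through real strict upper bounds, each of which
    provides a competitor; infinite values then need no case analysis. *)
Lemma lee_of_real_bounds x y :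
  (forall c : R, (y < c%:E)%E -> (x <= c%:E)%E) -> (x <= y)%E.
Proof.
case: y => [r| |] H; last 2 first.
- by rewrite leey.
- case: x H => [s| |] H //.
  + have := H (s - 1) (ltNyr _); rewrite lee_fin => ?; exfalso; lra.
  + by have := H 0 (ltNyr _).
apply/lee_addgt0Pr => e e0; rewrite -EFinD; apply: H.
by rewrite lte_fin ltrDl.
Qed.

Lemma lee_pM_of_real_bounds (C : R) x y : 0 < C ->
  (forall c : R, (y < c%:E)%E -> (x <= (C * c)%:E)%E) -> (x <= C%:E * y)%E.
Proof.
move=> C0 H; rewrite -lee_pdivrMl//; apply: lee_of_real_bounds => c yc.
by rewrite lee_pdivrMl// -EFinM; exact: H.
Qed.
End ereal_bounds.

(** The norm extended by +oo off the carrier is an extended seminorm; the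
    convention 0 * oo = 0 is consistent with the norm of 0 being 0. *)
Record seminormed (R : realType) (Z : lmodType R) (E : nspace Z) : Prop := {
  nrm_ge0 : forall f, (0 <= nrm E f)%E ;
  nrm_ltyP : forall f, carrier E f <-> (nrm E f < +oo)%E ;
  nrm_add : forall f g, (nrm E (f + g) <= nrm E f + nrm E g)%E ;
  nrm_scale : forall (a : R) f, (nrm E (a *: f) = `|a|%:E * nrm E f)%E }.

(** K(., t) is the norm of the sum of [E0] and of [E1] rescaled by t, so that
    what holds for sums holds for K-functionals. *)
Definition scaled_space (R : realType) (Z : lmodType R) (t : R) (E : nspace Z) :
  nspace Z := NSpace (carrier E) (fun f => (t%:E * nrm E f)%E).

Section seminormed_theory.
Variables (R : realType) (Z : lmodType R).
Implicit Types (E : nspace Z) (f g : Z).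

Lemma nrm0 E : seminormed E -> nrm E 0 = 0%E.
Proof. by move=> sE; rewrite -(scale0r 0) nrm_scale// normr0 mul0e. Qed.

Lemma nrmN E f : seminormed E -> nrm E (- f) = nrm E f.
Proof. by move=> sE; rewrite -scaleN1r nrm_scale// normrN1 mul1e. Qed.

Lemma nrm_sub E f g : seminormed E -> (nrm E (f - g) <= nrm E f + nrm E g)%E.
Proof. by move=> sE; rewrite -(nrmN g sE); exact: nrm_add. Qed.

Lemma carrier0 E : seminormed E -> carrier E 0.
Proof. by move=> sE; apply/nrm_ltyP => //; rewrite nrm0. Qed.

Lemma carrierD E f g : seminormed E -> carrier E f -> carrier E g -> carrier E (f + g).
Proof.
move=> sE /(nrm_ltyP sE) Ef /(nrm_ltyP sE) Eg; apply/nrm_ltyP => //.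
by apply: le_lt_trans (nrm_add sE _ _) _; exact: lte_add_pinfty.
Qed.

Lemma carrierZ E (a : R) f : seminormed E -> carrier E f -> carrier E (a *: f).
Proof.
move=> sE /(nrm_ltyP sE) Ef; apply/nrm_ltyP => //; rewrite nrm_scale//.
by rewrite lte_mul_pinfty.
Qed.

Lemma carrierN E f : seminormed E -> carrier E f -> carrier E (- f).
Proof. by move=> sE Ef; rewrite -scaleN1r; exact: carrierZ. Qed.

Lemma carrierB E f g : seminormed E -> carrier E f -> carrier E g -> carrier E (f - g).
Proof. by move=> sE Ef Eg; apply: carrierD => //; exact: carrierN. Qed.

Lemma nrm_sum_seq E (I : Type) (r : seq I) (F : I -> Z) : seminormed E ->
  (nrm E (\sum_(i <- r) F i) <= \sum_(i <- r) nrm E (F i))%E.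
Proof.
move=> sE; elim: r => [|i r IH]; first by rewrite !big_nil nrm0.
by rewrite !big_cons; apply: le_trans (nrm_add sE _ _) _; exact: leeD2l.
Qed.

Lemma embedded_seminormed (X : normedModType R) (i : {linear X -> Z}) :
  injective i -> seminormed (embedded i).
Proof.
move=> inj.
have nE x : nrm (embedded i) (i x) = `|x|%:E.
  rewrite /=; rewrite (_ : [set _ | _ in _] = [set `|x|%:E]) ?ereal_inf1//.
  by apply/seteqP; split => [_ [y /= /inj -> <-]//|_ ->]; exists x.
have nN z : ~ range i z -> nrm (embedded i) z = +oo%E.
  move=> zN; rewrite /= (_ : [set _ | _ in _] = set0) ?ereal_inf0//.
  by apply/seteqP; split => // _ [y /= yz _]; apply: zN; exists y.
have n0 f : (0 <= nrm (embedded i) f)%E.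
  by apply: le_ereal_inf_tmp => _ [x _ <-].
split => //.
- move=> f; split; first by move=> [x _ <-]; rewrite nE ltry.
  by apply: contraPP => /nN ->; rewrite ltxx.
- move=> f g.
  have [[x _ <-]|/nN ->] := pselect (range i f); last first.
    by rewrite addye ?leey// -ltNye (lt_le_trans _ (n0 g))// ltNyr.
  have [[y _ <-]|/nN ->] := pselect (range i g); last by rewrite nE addey ?leey.
  by rewrite -linearD !nE -EFinD lee_fin ler_normD.
- move=> a f.
  have [[x _ <-]|fN] := pselect (range i f).
    by rewrite -linearZ !nE normrZ EFinM.
  have [->|a0] := eqVneq a 0.
    by rewrite scale0r normr0 mul0e -(linear0 i) nE normr0.
  rewrite (nN f)// nN ?gt0_muley// ?lte_fin ?normr_gt0//.
  move=> [x _ xE]; apply: fN; exists (a^-1 *: x) => //.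
  by rewrite linearZ_LR/= xE scalerA mulVf// scale1r.
Qed.

Lemma scaled_seminormed (t : R) E : 0 < t -> seminormed E -> seminormed (scaled_space t E).
Proof.
move=> t0 sE; split => /=.
- by move=> f; rewrite mule_ge0 ?lee_fin ?(ltW t0)// (nrm_ge0 sE).
- move=> f; split=> [/(nrm_ltyP sE) Ef|]; first by rewrite lte_mul_pinfty// lee_fin ltW.
  move=> H; apply/(nrm_ltyP sE); move: H; rewrite !ltey; apply: contraNneq => ->.
  by rewrite gt0_muley.
- by move=> f g; rewrite -ge0_muleDr ?nrm_ge0// lee_pmul2l// nrm_add.
- by move=> a f; rewrite nrm_scale// muleCA.
Qed.

Section sums.
Variables E0 E1 : nspace Z.
Hypotheses (s0 : seminormed E0) (s1 : seminormed E1).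

Lemma sum_nrm_le f f0 f1 : carrier E0 f0 -> carrier E1 f1 -> f = f0 + f1 ->
  (nrm (sum_space E0 E1) f <= nrm E0 f0 + nrm E1 f1)%E.
Proof. by move=> c0 c1 ->; apply: ereal_inf_lbound; exists (f0, f1). Qed.

Lemma sum_nrm_lt f (c : \bar R) : (nrm (sum_space E0 E1) f < c)%E ->
  exists f0 f1, [/\ carrier E0 f0, carrier E1 f1, f = f0 + f1 &
    (nrm E0 f0 + nrm E1 f1 < c)%E].
Proof.
by move=> /ereal_inf_lt[_ [[f0 f1] [/= ? ? ?] <-] ?]; exists f0, f1.
Qed.

Lemma sum_seminormed : seminormed (sum_space E0 E1).
Proof.
have S0 f : (0 <= nrm (sum_space E0 E1) f)%E.
  by apply: le_ereal_inf_tmp => _ [p _ <-]; rewrite adde_ge0// nrm_ge0.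
have SZ (a : R) f : a != 0 ->
    (nrm (sum_space E0 E1) (a *: f) <= `|a|%:E * nrm (sum_space E0 E1) f)%E.
  move=> a0; have na : 0 < `|a| by rewrite normr_gt0.
  apply: lee_pM_of_real_bounds => // c /sum_nrm_lt[f0 [f1 [c0 c1 -> fc]]].
  rewrite scalerDr EFinM.
  apply: (le_trans (sum_nrm_le (carrierZ a s0 c0) (carrierZ a s1 c1) erefl)).
  by rewrite !nrm_scale// -ge0_muleDr ?nrm_ge0// lee_pmul2l// ltW.
split => //.
- move=> f; split.
    move=> [[f0 f1] [/= c0 c1 fE]].
    apply: le_lt_trans (sum_nrm_le c0 c1 fE) _.
    by apply: lte_add_pinfty; apply/nrm_ltyP.
  by move=> /sum_nrm_lt[f0 [f1 [? ? ? _]]]; exists (f0, f1).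
- move=> f g.
  apply: lee_of_real_bounds => c fgc.
  have ffin : nrm (sum_space E0 E1) f \is a fin_num.
    by rewrite ge0_fin_numE//; apply: le_lt_trans (lt_trans fgc (ltry _)); rewrite leeDl.
  have gfin : nrm (sum_space E0 E1) g \is a fin_num.
    by rewrite ge0_fin_numE//; apply: le_lt_trans (lt_trans fgc (ltry _)); rewrite leeDr.
  move: fgc; rewrite -(fineK ffin) -(fineK gfin) -EFinD lte_fin => fgc.
  set a := fine _ in fgc; set b' := fine _ in fgc.
  have [|f0 [f1 [cf0 cf1 fE fc]]] := @sum_nrm_lt f (a + (c - a - b') / 2)%:E.
    by rewrite -(fineK ffin) lte_fin -/a; lra.
  have [|g0 [g1 [cg0 cg1 gE gc]]] := @sum_nrm_lt g (b' + (c - a - b') / 2)%:E.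
    by rewrite -(fineK gfin) lte_fin -/b'; lra.
  apply: (@le_trans _ _ ((nrm E0 f0 + nrm E1 f1) + (nrm E0 g0 + nrm E1 g1))%E).
    rewrite addeACA; apply: le_trans (leeD (nrm_add s0 f0 g0) (nrm_add s1 f1 g1)).
    apply: sum_nrm_le; [exact: carrierD|exact: carrierD|].
    by rewrite fE gE addrACA.
  apply: (le_trans (leeD (ltW fc) (ltW gc))).
  by rewrite -EFinD lee_fin; lra.
- move=> a f; have [->|a0] := eqVneq a 0.
    rewrite scale0r normr0 mul0e; apply/eqP; rewrite eq_le S0 andbT.
    apply: (le_trans (sum_nrm_le (carrier0 s0) (carrier0 s1) (esym (addr0 0)))).
    by rewrite !nrm0// adde0.
  apply/eqP; rewrite eq_le SZ//=.
  have na : 0 < `|a| by rewrite normr_gt0.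
  rewrite -lee_pdivlMl// -normfV.
  apply: le_trans (SZ a^-1 (a *: f) _); last by rewrite invr_neq0.
  by rewrite scalerA mulVf// scale1r.
Qed.

Lemma Kfun_sum f t : Kfun E0 E1 f t = nrm (sum_space E0 (scaled_space t E1)) f.
Proof. by []. Qed.

Lemma Kfun_ge0 f t : 0 < t -> (0 <= Kfun E0 E1 f t)%E.
Proof.
move=> t0; rewrite Kfun_sum; apply: le_ereal_inf_tmp => _ [p _ <-].
apply: adde_ge0; first exact: (nrm_ge0 s0).
by apply: mule_ge0; [rewrite lee_fin ltW|exact: (nrm_ge0 s1)].
Qed.

Lemma sum_nrmE f : nrm (sum_space E0 E1) f = Kfun E0 E1 f 1.
Proof. by rewrite /Kfun/=; congr ereal_inf; apply: eq_imagel => p _; rewrite mul1e. Qed.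

Lemma Kfun_le f t f0 f1 : carrier E0 f0 -> carrier E1 f1 -> f = f0 + f1 ->
  (Kfun E0 E1 f t <= nrm E0 f0 + t%:E * nrm E1 f1)%E.
Proof. by move=> c0 c1 ->; apply: ereal_inf_lbound; exists (f0, f1). Qed.

Lemma Kfun_lt f t (c : \bar R) : (Kfun E0 E1 f t < c)%E ->
  exists f0 f1, [/\ carrier E0 f0, carrier E1 f1, f = f0 + f1 &
    (nrm E0 f0 + t%:E * nrm E1 f1 < c)%E].
Proof.
by move=> /ereal_inf_lt[_ [[f0 f1] [/= ? ? ?] <-] ?]; exists f0, f1.
Qed.

Lemma Kfun_mono f s t : s <= t -> (Kfun E0 E1 f s <= Kfun E0 E1 f t)%E.
Proof.
move=> st; apply: le_ereal_inf_tmp => _ [[f0 f1] [/= c0 c1 fE] <-].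
apply: le_trans (Kfun_le _ c0 c1 fE) _; apply: leeD => //.
by rewrite lee_wpmul2r ?nrm_ge0 ?lee_fin.
Qed.

Lemma Kfun_scale f s t : 0 < s -> s <= t ->
  (Kfun E0 E1 f t <= (t / s)%:E * Kfun E0 E1 f s)%E.
Proof.
move=> s_gt0 st.
have t_gt0 : 0 < t by exact: lt_le_trans st.
apply: lee_pM_of_real_bounds; first exact: divr_gt0.
move=> c /Kfun_lt[f0 [f1 [c0 c1 fE fc]]].
apply: le_trans (Kfun_le _ c0 c1 fE) _.
apply: (@le_trans _ _ ((t / s)%:E * (nrm E0 f0 + s%:E * nrm E1 f1))%E); last first.
  by rewrite [(t / s * c)%:E]EFinM lee_pmul2l ?lte_fin ?divr_gt0// ltW.
rewrite ge0_muleDr ?mule_ge0 ?nrm_ge0 ?lee_fin ?(ltW s_gt0)//.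
apply: leeD; last by rewrite muleA -EFinM divfK ?gt_eqF.
by rewrite lee_pemull ?nrm_ge0// lee_fin ler_pdivlMr// mul1r.
Qed.

Lemma Kfun_le_sum f t : 0 < t ->
  (Kfun E0 E1 f t <= (Num.max 1 t)%:E * nrm (sum_space E0 E1) f)%E.
Proof.
move=> t0; rewrite sum_nrmE; have [t1|t1] := leP t 1.
  by rewrite mul1e; exact: Kfun_mono.
by have := Kfun_scale f ltr01 (ltW t1); rewrite divr1.
Qed.

(** The two bounds come from the trivial decompositions f + 0 and 0 + f. *)
Lemma Kfun_le_J f s t : 0 < s -> 0 < t -> carrier (cap_space E0 E1) f ->
  (Kfun E0 E1 f t <= (Num.min 1 (t / s))%:E * Jfun E0 E1 f s)%E.
Proof.
move=> s_gt0 t_gt0 [c0 c1].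
have J0 : (0 <= Jfun E0 E1 f s)%E by rewrite /Jfun le_max nrm_ge0.
have [ts|ts] := leP 1 (t / s).
  rewrite mul1e; apply: (le_trans (Kfun_le _ c0 (carrier0 s1) (esym (addr0 f)))).
  by rewrite nrm0// mule0 adde0 /Jfun le_max lexx.
apply: (le_trans (Kfun_le _ (carrier0 s0) c1 (esym (add0r f)))).
rewrite nrm0// add0e; have {1}-> : t = t / s * s by rewrite divfK ?gt_eqF.
rewrite EFinM -muleA lee_pmul2l ?lte_fin ?divr_gt0//.
by rewrite /Jfun le_max lexx orbT.
Qed.

End sums.

Lemma Kfun_seminormed E0 E1 (t : R) : seminormed E0 -> seminormed E1 -> 0 < t ->
  seminormed (sum_space E0 (scaled_space t E1)).
Proof. by move=> s0 s1 t0; apply: sum_seminormed => //; exact: scaled_seminormed. Qed.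
End seminormed_theory.

(** * Weighted essential suprema and the couple (E0, E0 + E1) *)

Section Linfty_bounds.
Variable R : realType.
Local Notation lambda := (@lebesgue_measure R).
Implicit Types (g : R -> \bar R).

Lemma Linfty_leP g (N : \bar R) : (0 <= N)%E ->
  {ae lambda, forall s, 0 < s -> (0 <= g s)%E} ->
  (Linfty g <= N)%E <-> {ae lambda, forall s, 0 < s -> (g s <= N)%E}.
Proof.
move=> N0 g0; rewrite /Linfty Lnorm.unlock ifT; last first.
  rewrite (@lt_le_trans _ _ (lambda `]0%R, 1%R[))//.
    by rewrite lebesgue_measure_itv/= lte_fin ltr01 -EFinD lte_fin subr0.
  by apply: le_measure; rewrite ?inE.
have E : (\forall s \ae lambda, ((abse \o (g \_ `]0%R, +oo[)) s <= N)%E) <->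
    {ae lambda, forall s, 0 < s -> (g s <= N)%E}.
  split; move: g0; apply: filterS2; try exact: (ae_filter_ringOfSetsType lambda).
  - move=> s g0 /= + s_gt0; rewrite patchE mem_set/=; last by rewrite in_itv/= s_gt0.
    by rewrite gee0_abs// g0.
  - move=> s g0 /= H; rewrite patchE; case: ifPn => [|_]; last by rewrite abse0.
    by rewrite inE/= in_itv/= andbT => s_gt0; rewrite gee0_abs ?g0// H.
by rewrite -E; split => /ess_supP.
Qed.

Lemma Linfty_ge0 g : (0 <= Linfty g)%E.
Proof. exact: Lnorm_ge0. Qed.

Lemma ae_exists_itv (Q : R -> Prop) (a b : R) : a < b ->
  {ae lambda, forall s, Q s} -> exists s, [/\ a < s, s < b & Q s].
Proof.
move=> ab [N [mN N0 QN]]; apply: contrapT => H.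
have abN : `]a, b[%classic `<=` N.
  move=> s /=; rewrite in_itv/= => /andP[sa sb]; apply: QN => Qs.
  by apply: H; exists s.
have : (lambda `]a, b[ <= lambda N)%E by apply: le_measure; rewrite ?inE.
rewrite N0 lebesgue_measure_itv/= lte_fin ab -EFinD lee_fin subr_le0.
by rewrite leNgt ab.
Qed.

(** The set of admissible points is dense, and the inequality passes from
    points s slightly larger than t to t, since [k] is nondecreasing and [w] is
    continuous. *)
Lemma ae_le_everywhere (w : R -> R) (k : R -> \bar R) (N : R) (t : R) :
  0 < t -> (forall s, 0 < s -> 0 < w s) -> locally_abs_continuous w ->
  (forall r s, r <= s -> (k r <= k s)%E) -> (0 <= k t)%E ->
  {ae lambda, forall s, 0 < s -> ((w s)%:E * k s <= N%:E)%E} ->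
  ((w t)%:E * k t <= N%:E)%E.
Proof.
move=> t0 w0 acw kmono k0 H.
have wt := w0 t t0.
(* w is continuous at t and almost every s > t near t is admissible. *)
have H1 e : 0 < e -> exists s, [/\ 0 < s, w t - e < w s & ((w s)%:E * k t <= N%:E)%E].
  move=> e0.
  have /cvgrPdist_lt/(_ _ e0)/nbhs_ballP[d /= d0 bd] := locally_ac_cvg t0 acw.
  have [|s [ts sd ks]] := @ae_exists_itv _ t (t + d) _ H; first by rewrite ltrDl.
  have s_gt0 : 0 < s by exact: lt_trans ts.
  exists s; split => //.
    have /bd : ball t d s by rewrite /ball/= ltr0_norm; lra.
    by rewrite /= => /ltr_normlP[]; lra.
  apply: le_trans (ks s_gt0).
  by rewrite lee_pmul2l ?lte_fin ?w0//; apply: kmono; exact: ltW.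
have kfin : k t \is a fin_num.
  have [s [s_gt0 _ ks]] := H1 1 ltr01.
  rewrite ge0_fin_numE// ltey; apply: contraTneq ks => ->.
  by rewrite gt0_muley ?lte_fin ?w0.
move: H1 k0; rewrite -(fineK kfin); move: (fine _) => r H1.
rewrite lee_fin => r0; rewrite -EFinM lee_fin.
apply/ler_addgt0Pr => e e0.
have [|s [s_gt0 ws]] := H1 (e / (r + 1)).
  by rewrite divr_gt0//; lra.
rewrite -EFinM lee_fin => ks.
apply: (@le_trans _ _ ((w s + e / (r + 1)) * r)).
  by rewrite ler_wpM2r//; lra.
rewrite mulrDl lerD//.
rewrite mulrAC ler_pdivrMr; last by lra.
by rewrite ler_wpM2l//; lra.
Qed.
End Linfty_bounds.

Section spaces.
Variables (R : realType) (Z : lmodType R).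
Implicit Types (E F : nspace Z).

Lemma same_space_of_le E F (D : set Z) (C1 C2 : R) :
  0 < C1 -> 0 < C2 ->
  (forall f, carrier E f <-> D f /\ (nrm E f < +oo)%E) ->
  (forall f, carrier F f <-> D f /\ (nrm F f < +oo)%E) ->
  (forall f, D f -> (0 <= nrm E f)%E /\ (0 <= nrm F f)%E) ->
  (forall f, D f -> (nrm E f <= C1%:E * nrm F f)%E) ->
  (forall f, D f -> (nrm F f <= C2%:E * nrm E f)%E) ->
  same_space E F.
Proof.
move=> C10 C20 cE cF ge0 EF FE; split.
  apply/seteqP; split => f.
  - move=> /cE[Df Ef]; apply/cF; split => //.
    by apply: le_lt_trans (FE f Df) _; rewrite lte_mul_pinfty ?lee_fin ?ltW.
  - move=> /cF[Df Ff]; apply/cE; split => //.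
    by apply: le_lt_trans (EF f Df) _; rewrite lte_mul_pinfty ?lee_fin ?ltW.
exists (Num.max C1 C2); first by rewrite lt_max C10.
move=> f /cE[Df _]; have [E0 F0] := ge0 f Df; split.
  apply: le_trans (EF f Df) _; apply: lee_wpmul2r => //.
  by rewrite lee_fin le_max lexx.
apply: le_trans (FE f Df) _; apply: lee_wpmul2r => //.
by rewrite lee_fin le_max lexx orbT.
Qed.

Variables E0 E1 : nspace Z.
Hypotheses (s0 : seminormed E0) (s1 : seminormed E1).

(** For t >= 1 the part of the second component that lies in [E0] can be moved
    to the first component without increasing the cost. *)
Lemma Kfun_sum_ge1 f t : 1 <= t ->
  Kfun E0 (sum_space E0 E1) f t = Kfun E0 E1 f t.
Proof.
move=> t1; have t0 : 0 < t by exact: lt_le_trans t1.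
apply/eqP; rewrite eq_le; apply/andP; split.
  apply: lee_of_real_bounds => c /Kfun_lt[f0 [f1 [c0 c1 fE fc]]].
  apply: le_trans (ltW fc); apply: (le_trans (Kfun_le _ c0 _ fE)).
    by exists (0, f1); split => //=; [exact: carrier0|rewrite add0r].
  apply: leeD => //; rewrite lee_pmul2l//.
  apply: (le_trans (sum_nrm_le (carrier0 s0) c1 (esym (add0r f1)))).
  by rewrite nrm0// add0e.
apply: lee_of_real_bounds => c /Kfun_lt[f0 [g [c0 cg fE fc]]].
have g_fin : nrm (sum_space E0 E1) g \is a fin_num.
  rewrite ge0_fin_numE; last exact: (nrm_ge0 (sum_seminormed s0 s1)).
  by apply/(nrm_ltyP (sum_seminormed s0 s1)).
have f0_fin : nrm E0 f0 \is a fin_num.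
  by rewrite ge0_fin_numE ?nrm_ge0//; apply/nrm_ltyP.
move: fc; rewrite -(fineK g_fin) -(fineK f0_fin) -EFinM -EFinD lte_fin => fc.
set G := fine (nrm (sum_space E0 E1) g) in fc.
set F := fine (nrm E0 f0) in fc.
have [|g0 [g1 [cg0 cg1 gE gc]]] := @sum_nrm_lt _ _ E0 E1 g (G + (c - F - t * G) / t)%:E.
  by rewrite -(fineK g_fin) lte_fin -/G ltrDl divr_gt0//; lra.
apply: (@le_trans _ _ (nrm E0 (f0 + g0) + t%:E * nrm E1 g1)%E).
  by apply: Kfun_le => //; [exact: carrierD|rewrite fE gE addrA].
apply: (@le_trans _ _ (nrm E0 f0 + t%:E * (nrm E0 g0 + nrm E1 g1))%E).
  rewrite ge0_muleDr ?nrm_ge0// addeA; apply: leeD => //.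
  apply: le_trans (nrm_add s0 _ _) _; apply: leeD => //.
  by rewrite lee_pemull ?nrm_ge0// lee_fin.
apply: (@le_trans _ _ (nrm E0 f0 + t%:E * (G + (c - F - t * G) / t)%:E)%E).
  by apply: leeD => //; rewrite lee_pmul2l// ltW.
rewrite -(fineK f0_fin) -EFinM -EFinD lee_fin -/F.
by rewrite mulrDr [t * (_ / _)]mulrCA mulfV ?gt_eqF//; lra.
Qed.

(** The decomposition 0 + f. *)
Lemma Kfun_sum_le f t : carrier (sum_space E0 E1) f ->
  (Kfun E0 (sum_space E0 E1) f t <= t%:E * Kfun E0 E1 f 1)%E.
Proof.
move=> cf; apply: (le_trans (Kfun_le _ (carrier0 s0) cf (esym (add0r f)))).
by rewrite nrm0// add0e sum_nrmE.
Qed.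

Lemma carrier_sum_sum f :
  carrier (sum_space E0 (sum_space E0 E1)) f <-> carrier (sum_space E0 E1) f.
Proof.
split => [[[f0 g] /= [c0 [[g0 g1] /= [cg0 cg1 gE]] fE]]|cf].
  by exists (f0 + g0, g1); split => //=; [exact: carrierD|rewrite fE gE addrA].
by exists (0, f); split => //=; [exact: carrier0|rewrite add0r].
Qed.

Lemma Kspace_sum (b B : R -> R) (M M' : R) :
  (forall t, 0 < t -> 0 < b t) -> (forall t, 0 < t -> 0 < B t) ->
  locally_abs_continuous b -> locally_abs_continuous B ->
  (forall t, 1 <= t -> B t = b t) ->
  (forall t, 0 < t -> b t <= M) ->
  (forall t, 0 < t -> t <= 1 -> t * B t <= M') ->
  same_space (Kspace E0 E1 (fun t => (b t)%:E))
             (Kspace E0 (sum_space E0 E1) (fun t => (B t)%:E)).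
Proof.
move=> b0 B0 acb acB Bb bM BM'.
have ss := sum_seminormed s0 s1.
have b10 := b0 1 ltr01.
have M0 : 0 < M by exact: lt_le_trans b10 (bM _ ltr01).
have bM1 : b 1 <= M by exact: bM.
have M'0 : 0 < M' by apply: lt_le_trans (BM' 1 ltr01 (lexx _)); rewrite mul1r B0.
have bM'1 : b 1 <= M' by rewrite -Bb// -[B 1]mul1r BM'.
have Kb0 f : {ae lebesgue_measure, forall t, 0 < t -> (0 <= (b t)%:E * Kfun E0 E1 f t)%E}.
  apply: aeW => t t0; rewrite mule_ge0 ?lee_fin ?(ltW (b0 _ _))//; exact: Kfun_ge0.
have KB0 f : {ae lebesgue_measure, forall t, 0 < t ->
    (0 <= (B t)%:E * Kfun E0 (sum_space E0 E1) f t)%E}.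
  apply: aeW => t t0; rewrite mule_ge0 ?lee_fin ?(ltW (B0 _ _))//; exact: Kfun_ge0.
apply: (@same_space_of_le _ _ (carrier (sum_space E0 E1)) (M / b 1) (M' / b 1)).
- by rewrite divr_gt0.
- by rewrite divr_gt0.
- by [].
- move=> f /=; split => [[/carrier_sum_sum]|[]]; first by [].
  by move=> /carrier_sum_sum.
- by move=> f _; split; exact: Linfty_ge0.
- move=> f cf; apply: lee_pM_of_real_bounds; first by rewrite divr_gt0.
  move=> N HN.
  have N0 : 0 < N by rewrite -lte_fin; apply: le_lt_trans HN; exact: Linfty_ge0.
  have {}HN := (Linfty_leP (ltW N0 : (0 <= N%:E)%E) (KB0 f)).1 (ltW HN).
  have H1 : ((b 1)%:E * Kfun E0 E1 f 1 <= N%:E)%E.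
    rewrite -Bb// -Kfun_sum_ge1//.
    apply: (ae_le_everywhere (k := Kfun E0 (sum_space E0 E1) f)) HN => //.
      by move=> *; exact: Kfun_mono.
    exact: Kfun_ge0.
  apply/(Linfty_leP _ (Kb0 f)); first by rewrite lee_fin mulr_ge0 ?divr_ge0// ltW.
  apply: filterS HN; first exact: (ae_filter_ringOfSetsType lebesgue_measure).
  move=> s HN s_gt0; have [s1'|s1'] := leP 1 s.
    apply: (@le_trans _ _ N%:E).
      by have := HN s_gt0; rewrite Kfun_sum_ge1// Bb.
    by rewrite lee_fin ler_peMl ?(ltW N0)// ler_pdivlMr// mul1r.
  apply: (@le_trans _ _ (M%:E * Kfun E0 E1 f 1)%E).
    apply: lee_pmul; rewrite ?lee_fin ?(ltW (b0 _ _)) ?bM//; first exact: Kfun_ge0.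
    by apply: Kfun_mono => //; exact: ltW.
  rewrite [X in (X * _ <= _)%E](_ : _ = (M / b 1)%:E * (b 1)%:E)%E; last first.
    by rewrite -EFinM divfK ?gt_eqF.
  by rewrite -muleA [leRHS]EFinM lee_pmul2l ?lte_fin ?divr_gt0.
- move=> f cf; apply: lee_pM_of_real_bounds; first by rewrite divr_gt0.
  move=> N HN.
  have N0 : 0 < N by rewrite -lte_fin; apply: le_lt_trans HN; exact: Linfty_ge0.
  have {}HN := (Linfty_leP (ltW N0 : (0 <= N%:E)%E) (Kb0 f)).1 (ltW HN).
  have H1 : ((b 1)%:E * Kfun E0 E1 f 1 <= N%:E)%E.
    apply: (ae_le_everywhere (k := Kfun E0 E1 f)) HN => //.
      by move=> *; exact: Kfun_mono.
    exact: Kfun_ge0.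
  apply/(Linfty_leP _ (KB0 f)); first by rewrite lee_fin mulr_ge0 ?divr_ge0// ltW.
  apply: filterS HN; first exact: (ae_filter_ringOfSetsType lebesgue_measure).
  move=> s HN s_gt0; have [s1'|s1'] := leP 1 s.
    apply: (@le_trans _ _ N%:E).
      by have := HN s_gt0; rewrite Kfun_sum_ge1// Bb.
    by rewrite lee_fin ler_peMl ?(ltW N0)// ler_pdivlMr// mul1r.
  apply: (@le_trans _ _ ((B s)%:E * (s%:E * Kfun E0 E1 f 1))%E).
    by rewrite lee_pmul2l ?lte_fin ?B0//; exact: Kfun_sum_le.
  apply: (@le_trans _ _ (M'%:E * Kfun E0 E1 f 1)%E).
    rewrite muleA -EFinM; apply: lee_wpmul2r; first exact: Kfun_ge0.
    by rewrite lee_fin mulrC BM'// ltW.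
  rewrite [X in (X * _ <= _)%E](_ : _ = (M' / b 1)%:E * (b 1)%:E)%E; last first.
    by rewrite -EFinM divfK ?gt_eqF.
  by rewrite -muleA [leRHS]EFinM lee_pmul2l ?lte_fin ?divr_gt0.
Qed.
End spaces.

(** * Simple functions and lower integrals *)

Section simple_functions.
Context d (T : measurableType d) (R : realType) (mu : {measure set T -> \bar R}).
Variables (Z : lmodType R) (D : set T) (mD : measurable D).

Section composition.
Variables (E : nspace Z) (s : T -> Z).
Hypothesis ss : simple_on D E s.
Variable q : Z -> \bar R.
Hypothesis q0 : forall z, (0 <= q z)%E.

Let A := s @` D.

Let finA : finite_set A. Proof. by case: ss. Qed.

Let mlevel z : measurable (D `&` s @^-1` [set z]). Proof. by case: ss. Qed.

Let compE x : D x ->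
  q (s x) = (\sum_(z \in A) (q z * (\1_(D `&` s @^-1` [set z]) x)%:E))%E.
Proof.
move=> Dx; have Asx : A (s x) by exists x.
rewrite (fsbigD1 (s x))//= fsbig1 ?adde0.
  by rewrite indicE mem_set// mule1.
move=> z [Az zsx]; rewrite indicE memNset ?mule0// => -[_ /= sz].
by apply: zsx; rewrite /= sz.
Qed.

Lemma measurable_simple_comp : measurable_fun D (fun x => q (s x)).
Proof.
apply: (@eq_measurable_fun _ _ _ _ D
  (fun x => (\sum_(z \in A) (q z * (\1_(D `&` s @^-1` [set z]) x)%:E))%E)).
  by move=> x /set_mem Dx; rewrite compE.
apply: emeasurable_fsum => // z.
by apply: measurable_funeM; apply/measurable_EFinP; exact: measurable_indic.
Qed.

Lemma integral_simple_comp : (\int[mu]_(x in D) q (s x) =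
  \sum_(z \in A) (q z * mu (D `&` s @^-1` [set z])))%E.
Proof.
rewrite (eq_integral
  (fun x => (\sum_(z \in A) (q z * (\1_(D `&` s @^-1` [set z]) x)%:E))%E)); last first.
  by move=> x /set_mem Dx; rewrite compE.
rewrite ge0_integral_fsum//; last 2 first.
- by move=> z; apply: measurable_funeM; apply/measurable_EFinP; exact: measurable_indic.
- by move=> z x _; rewrite mule_ge0// lee_fin.
apply: eq_fsbigr => z _.
rewrite ge0_integralZl//.
- by rewrite integral_indic// setIAC setIid.
- by apply/measurable_EFinP; exact: measurable_indic.
Qed.
End composition.

(** Minkowski's inequality for a simple function, with respect to any extended
    seminorm. *)
Lemma nrm_simple_integral_le (E F : nspace Z) (s : T -> Z) :
  seminormed E -> simple_on D F s ->
  (forall z, z != 0 -> (mu (D `&` s @^-1` [set z]) < +oo)%E) ->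
  (nrm E (simple_integral mu D s) <= \int[mu]_(x in D) nrm E (s x))%E.
Proof.
move=> sE ss sfin; rewrite (integral_simple_comp ss); last exact: nrm_ge0.
have fA : finite_set (s @` D) by case: ss.
rewrite /simple_integral !fsbig_finite//=.
apply: le_trans (nrm_sum_seq _ _ sE) _; apply: lee_sum => z _.
rewrite nrm_scale//; have [->|z0] := eqVneq z 0; first by rewrite nrm0// mule0 mul0e.
rewrite ger0_norm ?fine_ge0// fineK; first by rewrite muleC.
by rewrite ge0_fin_numE// sfin.
Qed.

(** The error term [h] below is a norm of a vector-valued function, about which
    only the lower integral is known. The measurable function (F - G)^+ is
    almost everywhere below [h], and lower integrals are monotone. *)
Lemma ge0_integral_le_add (F G : T -> R) (h : T -> \bar R) :
  measurable_fun D F -> measurable_fun D G ->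
  (forall x, D x -> 0 <= F x) -> (forall x, D x -> 0 <= G x) ->
  (forall x, D x -> (0 <= h x)%E) ->
  {ae mu, forall x, D x -> ((F x)%:E <= (G x)%:E + h x)%E} ->
  (\int[mu]_(x in D) (F x)%:E <=
    \int[mu]_(x in D) (G x)%:E + \int[mu]_(x in D) h x)%E.
Proof.
move=> mF mG F0 G0 h0 [N [mN N0 HN]].
pose e x := Num.max 0 (F x - G x).
have e0 x : 0 <= e x by rewrite le_max lexx.
have me : measurable_fun D e by apply: measurable_maxr => //; exact: measurable_funB.
apply: (@le_trans _ _ (\int[mu]_(x in D) ((G x)%:E + (e x)%:E))%E).
  apply: ge0_le_integral => //.
  - exact/measurable_EFinP.
  - by apply: emeasurable_funD; exact/measurable_EFinP.
  - by move=> x Dx; rewrite -EFinD lee_fin /e -lerBlDl le_max lexx orbT.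
rewrite ge0_integralD//; try exact/measurable_EFinP; try by move=> x _; rewrite lee_fin.
apply: leeD => //.
(* Off N the function e lies below h, so e' lies below h everywhere. *)
pose e' x := e x * \1_(~` N) x.
have me' : measurable_fun D e'.
  by apply: measurable_funM => //; apply: measurable_indic; exact: measurableC.
have -> : (\int[mu]_(x in D) (e x)%:E = \int[mu]_(x in D) (e' x)%:E)%E.
  apply: ae_eq_integral => //; [exact/measurable_EFinP|exact/measurable_EFinP|].
  exists N; split => // x H; apply: contrapT => Nx; apply: H => Dx /=.
  by rewrite /e' indicE mem_set// mulr1.
have e'0 x : 0 <= e' x by rewrite mulr_ge0.
have e'h x : D x -> ((e' x)%:E <= h x)%E.
  move=> Dx; rewrite /e' indicE; have [Nx|Nx] := pselect (N x).
    by rewrite memNset ?mulr0 ?h0// => /(_ Nx).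
  rewrite mem_set// mulr1 /e.
  have : ((F x)%:E <= (G x)%:E + h x)%E.
    by apply: contrapT => H; apply: Nx; apply: HN => /(_ Dx).
  move=> H; by rewrite EFin_max ge_max h0//= EFinB leeBlDl// addeC.
rewrite !ge0_integralE//; last by move=> x _; rewrite lee_fin.
apply: le_ereal_sup => _ [g ge' <-]; exists g => // x.
apply: le_trans (ge' x) _; rewrite !patchE; case: ifPn => // /set_mem Dx.
exact: e'h.
Qed.
End simple_functions.

(** * From J to K *)

Section J_to_K.
Variables (R : realType) (Z : lmodType R) (E0 E1 : nspace Z).
Hypotheses (s0 : seminormed E0) (s1 : seminormed E1).
Variables (phi psi : R -> R) (C : R) (A : R -> \bar R).
Hypothesis P : increasing_primitive phi psi.
Hypothesis G : sqrt_growth C phi.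
Local Notation lambda := (@lebesgue_measure R).
Hypothesis AE : {ae lambda, forall s, 0 < s -> A s = (((s * psi s)%:E)^-1)%E}.

Lemma Jfun_ge0 f t : (0 <= Jfun E0 E1 f t)%E.
Proof. by rewrite /Jfun le_max (nrm_ge0 s0). Qed.

(** For [a] = 0 the inverse is +oo, and a finite product forces [x] = 0. *)
Lemma inve_mul_le (a N : R) (x : \bar R) : 0 <= a -> (0 <= x)%E ->
  ((a%:E)^-1 * x <= N%:E)%E -> (x <= (a * N)%:E)%E.
Proof.
move=> a0 x0; rewrite inver; case: eqP => [->|/eqP a_neq0].
  rewrite mul0r; move: x0; rewrite le_eqVlt => /predU1P[<-//|x0].
  by rewrite gt0_mulye// leye_eq.
have ap : 0 < a by rewrite lt_neqAle eq_sym a_neq0.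
by move=> H; rewrite EFinM -lee_pdivrMl.
Qed.

(** The seminorm K(., t) of the integral of a simple function is at most the
    integral of K(., t) along it. Simple approximants s_n of u(s) / s satisfy
    K(s_n, t) <= N min(1, t / s) psi(s) + K(u(s) / s - s_n, t), where the last
    term has small integral because K(., t) is bounded by a multiple of the norm
    of the sum. *)
Lemma represents_Kfun_le (u : R -> Z) (f : Z) (N t : R) : 0 <= N -> 0 < t ->
  represents E0 E1 u f ->
  (Linfty (fun s => (A s * Jfun E0 E1 (u s) s)%E) <= N%:E)%E ->
  (Kfun E0 E1 f t <= (5 * C * N * phi t)%:E)%E.
Proof.
move=> N0 t0 [[ucap _] [_ _ [s_ [ss sfin cvb cva]]]] LN.
pose D := (`]0, +oo[%classic : set R).
have mD : measurable D by exact: measurable_itv.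
have sS := sum_seminormed s0 s1.
have sK := Kfun_seminormed s0 s1 t0.
pose m := Num.max 1 t.
have m0 : 0 < m by rewrite lt_max ltr01.
pose K z := nrm (sum_space E0 (scaled_space t E1)) z.
have K0 z : (0 <= K z)%E by exact: (nrm_ge0 sK).
have KS z : (K z <= m%:E * nrm (sum_space E0 E1) z)%E by exact: (Kfun_le_sum s0 s1).
pose g s := N * (Num.min 1 (t / s) * psi s).
have psi0 := density_ge0 P.
have g0 s : D s -> 0 <= g s.
  rewrite /D/= in_itv/= andbT => s_gt0.
  by rewrite mulr_ge0// mulr_ge0// le_min ler01 divr_ge0// ltW.
have mg : measurable_fun D g by apply: measurable_funM => //; exact: (measurable_kernel P).
have Kg : {ae lambda, forall s, D s -> (K (s^-1 *: u s) <= (g s)%:E)%E}.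
  have HA : {ae lambda, forall s, 0 < s -> (A s * Jfun E0 E1 (u s) s <= N%:E)%E}.
    apply/Linfty_leP => //.
    move: AE; apply: filterS; first exact: (ae_filter_ringOfSetsType lambda).
    move=> s HE s_gt0; rewrite HE// mule_ge0 ?Jfun_ge0// inve_ge0 lee_fin.
    by rewrite mulr_ge0// ltW.
  (* Where psi vanishes, A is infinite and the bound forces J(u(s), s) = 0. *)
  move: HA AE; apply: filterS2; first exact: (ae_filter_ringOfSetsType lambda).
  move=> s HA HE Ds; have s_gt0 : 0 < s by move: Ds; rewrite /D/= in_itv/= andbT.
  have := HA s_gt0; rewrite HE// => /inve_mul_le HJ.
  have {}HJ := HJ (mulr_ge0 (ltW s_gt0) (psi0 s)) (Jfun_ge0 _ _).
  rewrite /K nrm_scale// gtr0_norm ?invr_gt0//.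
  have cu : carrier (cap_space E0 E1) (u s) by apply: ucap; exists s.
  apply: (@le_trans _ _ ((s^-1)%:E *
      ((Num.min 1 (t / s))%:E * (s * psi s * N)%:E))%E).
    rewrite lee_pmul2l ?lte_fin ?invr_gt0//.
    apply: (le_trans (Kfun_le_J s0 s1 s_gt0 t0 cu)).
    by rewrite lee_pmul2l ?lte_fin// lt_min ltr01 divr_gt0.
  rewrite -!EFinM lee_fin /g le_eqVlt; apply/orP; left; apply/eqP.
  by field; rewrite gt_eqF.
have Ig : (\int[lambda]_(s in D) (g s)%:E <= (5 * C * N * phi t)%:E)%E.
  under eq_integral do rewrite EFinM.
  rewrite ge0_integralZl//; last 2 first.
  - by apply/measurable_EFinP; exact: (measurable_kernel P).
  - by move=> s; rewrite /D/= in_itv/= andbT => s_gt0; rewrite lee_fin mulr_ge0// le_min ler01 divr_ge0// ltW.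
  apply: (@le_trans _ _ (N%:E * (5 * C * phi t)%:E)%E).
    by apply: lee_wpmul2l; [rewrite lee_fin|exact: (integral_kernel P G t0)].
  by rewrite -EFinM lee_fin le_eqVlt; apply/orP; left; apply/eqP; ring.
pose a n := nrm (sum_space E0 E1) (f - simple_integral lambda D (s_ n)).
pose b n := (\int[lambda]_(s in D) nrm (sum_space E0 E1) (s^-1 *: u s - s_ n s))%E.
have key n : (K f <= m%:E * a n + ((5 * C * N * phi t)%:E + m%:E * b n))%E.
  pose S := simple_integral lambda D (s_ n).
  apply: (@le_trans _ _ (K (f - S)%R + K S)%E).
    by rewrite -{1}(subrK S f); exact: (nrm_add sK).
  apply: leeD; first exact: KS.
  apply: (@le_trans _ _ (\int[lambda]_(s in D) K (s_ n s))%E).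
    exact: (@nrm_simple_integral_le _ _ R lambda Z D mD _ _ (s_ n) sK (ss n) (sfin n)).
  have cs s : D s -> carrier (sum_space E0 E1) (s_ n s).
    by move=> Ds; case: (ss n) => + _ _; apply; exists s.
  have Kfin s : D s -> K (s_ n s) \is a fin_num.
    move=> Ds; rewrite ge0_fin_numE//; apply: le_lt_trans (KS _) _.
    rewrite lte_mul_pinfty ?lee_fin ?(ltW m0)//.
    by apply/(nrm_ltyP sS); exact: cs.
  (* Dividing by m here avoids scaling the integral of the norm of
     u(s) / s - s_n, which is only a lower integral. *)
  pose F s := fine (K (s_ n s)) / m.
  have FE s : D s -> K (s_ n s) = (m%:E * (F s)%:E)%E.
    move=> Ds; rewrite -EFinM /F mulrCA mulfV ?gt_eqF// mulr1 fineK//; exact: Kfin.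
  have mF : measurable_fun D F.
    apply: measurable_funM => //; apply: (@measurableT_comp _ _ _ _ _ _ fine) => //.
    exact: (measurable_simple_comp (ss n) K).
  have F0 s : D s -> 0 <= F s by move=> _; rewrite divr_ge0 ?fine_ge0// ltW.
  rewrite (eq_integral (fun s => m%:E * (F s)%:E)%E); last first.
    by move=> s /set_mem Ds; exact: FE.
  rewrite ge0_integralZl//; last 2 first.
  - exact/measurable_EFinP.
  - by rewrite lee_fin ltW.
  apply: (@le_trans _ _ (m%:E * (\int[lambda]_(s in D) (g s / m)%:E + b n))%E).
    rewrite lee_pmul2l//; apply: ge0_integral_le_add => //.
    - exact: measurable_funM.
    - by move=> s Ds; rewrite divr_ge0 ?g0// ltW.
    - by move=> s Ds; exact: (nrm_ge0 sS).
    move: Kg; apply: filterS; first exact: (ae_filter_ringOfSetsType lambda).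
    move=> s Kg Ds.
    rewrite -(@lee_pmul2l _ m%:E)// -FE// ge0_muleDr ?lee_fin ?divr_ge0 ?g0 ?(ltW m0)//; last first.
      exact: (nrm_ge0 sS).
    rewrite -EFinM mulrCA mulfV ?gt_eqF// mulr1.
    apply: (@le_trans _ _ (K (s^-1 *: u s)%R + K (s^-1 *: u s - s_ n s)%R)%E).
      by rewrite -{1}(subKr (s^-1 *: u s) (s_ n s)); exact: nrm_sub.
    by apply: leeD; [exact: Kg|exact: KS].
  rewrite ge0_muleDr; last 2 first.
  - by apply: integral_ge0 => s Ds; rewrite lee_fin divr_ge0 ?g0// ltW.
  - by apply: integral_ge0 => s Ds; exact: (nrm_ge0 sS).
  apply: leeD => //; apply: le_trans Ig.
  rewrite -ge0_integralZl//; last 3 first.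
  - by apply/measurable_EFinP; exact: measurable_funM.
  - by move=> s Ds; rewrite lee_fin divr_ge0 ?g0// ltW.
  - by rewrite lee_fin ltW.
  under eq_integral do rewrite -EFinM mulrCA mulfV ?gt_eqF// mulr1.
  exact: lexx.
have cv : (m%:E * a n + ((5 * C * N * phi t)%:E + m%:E * b n))%E @[n --> \oo] -->
    (m%:E * 0 + ((5 * C * N * phi t)%:E + m%:E * 0))%E.
  apply: cvgeD => //.
  - by apply: cvgeZl.
  - by apply: cvgeD => //; [exact: cvg_cst|exact: cvgeZl].
move: cv; rewrite !mule0 adde0 add0e => cv.
rewrite -(cvg_lim _ cv)//; apply: lime_ge; last exact: nearW.
by apply/cvg_ex; eexists; exact: cv.
Qed.
End J_to_K.

(** * Integrals of simple functions along a partition *)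

Section integral_tools.
Context d (T : measurableType d) (R : realType) (mu : {measure set T -> \bar R}).
Variables (D : set T) (mD : measurable D).

(** The integral of a nonnegative function is a supremum over the simple
    functions below it, and this supremum is monotone in the function. *)
Lemma ge0_le_lower_integral (f g : T -> \bar R) :
  (forall x, D x -> (0 <= f x)%E) -> (forall x, D x -> (f x <= g x)%E) ->
  (\int[mu]_(x in D) f x <= \int[mu]_(x in D) g x)%E.
Proof.
move=> f0 fg.
have g0 x : D x -> (0 <= g x)%E by move=> Dx; rewrite (le_trans (f0 x Dx)) ?fg.
rewrite !ge0_integralE//; apply: le_ereal_sup => _ [h hf <-]; exists h => // x.
apply: le_trans (hf x) _; rewrite !patchE; case: ifPn => // /set_mem Dx.
exact: fg.
Qed.

Section finite_valued.
Variables (I : choiceType) (idx : T -> I).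
Hypothesis fidx : finite_set (idx @` D).
Hypothesis midx : forall i, measurable (D `&` idx @^-1` [set i]).

Lemma measurable_finite_valued (Q : set I) : measurable (D `&` idx @^-1` Q).
Proof.
have -> : D `&` idx @^-1` Q = \bigcup_(i in (idx @` D) `&` Q) (D `&` idx @^-1` [set i]).
  apply/seteqP; split => [x [Dx Qx]|x [i [_ Qi] [Dx /= xi]]].
    by exists (idx x) => //; split => //; exists x.
  by split => //=; rewrite xi.
by apply: fin_bigcup_measurable => //; exact: finite_setIl.
Qed.

Variables (Z : lmodType R) (z : I -> Z).
Hypothesis finidx : forall i, z i != 0 -> (mu (D `&` idx @^-1` [set i]) < +oo)%E.

Lemma measure_level_comp y : mu (D `&` (z \o idx) @^-1` [set y]) =
  (\sum_(i <- fset_set (idx @` D) | z i == y) mu (D `&` idx @^-1` [set i]))%E.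
Proof.
have -> : D `&` (z \o idx) @^-1` [set y] =
    \bigcup_(i in (idx @` D) `&` z @^-1` [set y]) (D `&` idx @^-1` [set i]).
  apply/seteqP; split => [x [Dx /= Qx]|x [i [_ /= Qi] [Dx /= xi]]].
    by exists (idx x) => //; split => //; exists x.
  by split => //=; rewrite xi.
rewrite measure_fin_bigcup//; last 2 first.
- exact: finite_setIl.
- by move=> i j _ _ [x [[_ <-] [_ <-]]].
rewrite fsbig_mkcondr fsbig_finite//= [RHS]big_mkcond/=.
apply: eq_bigr => i _; congr (if _ then _ else _).
by apply/idP/eqP => [/set_mem|zi] //; exact/mem_set.
Qed.

Let level_fin y i : y != 0 -> z i == y ->
  mu (D `&` idx @^-1` [set i]) \is a fin_num.
Proof. by move=> y0 /eqP zi; rewrite ge0_fin_numE// finidx// zi. Qed.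

Lemma level_comp_lty y : y != 0 ->
  (mu (D `&` (z \o idx) @^-1` [set y]) < +oo)%E.
Proof.
move=> y0; rewrite measure_level_comp; apply: lte_sum_pinfty => i zi.
by rewrite -ge0_fin_numE//; exact: level_fin zi.
Qed.

(** Grouping the pieces of a finite partition on which the function takes the
    same value gives back its level sets, so the integral may be computed from
    any such partition. *)
Lemma simple_integral_comp : simple_integral mu D (z \o idx) =
  \sum_(i \in idx @` D) fine (mu (D `&` idx @^-1` [set i])) *: z i.
Proof.
rewrite /simple_integral -image_comp.
rewrite fsbig_finite; last exact: finite_image.
rewrite (fset_set_image _ fidx).
rewrite [RHS]fsbig_finite//= (partition_big_imfset _ z)/=.
apply: eq_bigr => y _.
transitivity (\sum_(i <- fset_set (idx @` D) | z i == y)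
    fine (mu (D `&` idx @^-1` [set i])) *: y); last first.
  by apply: eq_bigr => i /eqP ->.
rewrite -scaler_suml.
have [->|y0] := eqVneq y 0; first by rewrite !scaler0.
congr (_ *: _); rewrite measure_level_comp sum_fine// => i.
exact: level_fin.
Qed.
End finite_valued.
End integral_tools.

(** * Functions on a partition of the half-line *)

Lemma cap_seminormed (R : realType) (Z : lmodType R) (E0 E1 : nspace Z) :
  seminormed E0 -> seminormed E1 -> seminormed (cap_space E0 E1).
Proof.
move=> s0 s1; split => /=.
- by move=> f; rewrite le_max (nrm_ge0 s0).
- move=> f; rewrite gt_max; split.
    by move=> [/(nrm_ltyP s0) -> /(nrm_ltyP s1) ->].
  by move=> /andP[/(nrm_ltyP s0) ? /(nrm_ltyP s1) ?].
- move=> f g; rewrite ge_max; apply/andP; split.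
    by apply: le_trans (nrm_add s0 _ _) _; apply: leeD; rewrite le_max lexx.
  by apply: le_trans (nrm_add s1 _ _) _; apply: leeD; rewrite le_max lexx orbT.
- move=> a f; rewrite (nrm_scale s0) (nrm_scale s1).
  by rewrite maxe_pMr// lee_fin.
Qed.

Section blocks.
Variables (R : realType) (t : int -> R) (block_of : R -> int).
Hypothesis t_gt0 : forall k, 0 < t k.
Hypothesis t_lt : forall k l : int, k < l -> t k < t l.
Hypothesis block_ofP : forall s, 0 < s -> t (block_of s) < s <= t (block_of s + 1).
Local Notation lambda := (@lebesgue_measure R).
Let D := (`]0, +oo[%classic : set R).

(** The half-line is cut at the increasing times [t k], for k an integer;
    [block_of s] is the index of the piece that contains [s]. *)
Definition block (k : int) : set R := `]t k, t (k + 1)]%classic.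

Lemma level_time_le (k l : int) : k <= l -> t k <= t l.
Proof. by rewrite le_eqVlt => /predU1P[->//|/t_lt/ltW]. Qed.

Lemma block_of_unique (s : R) (k : int) : t k < s -> s <= t (k + 1) -> block_of s = k.
Proof.
move=> ks sk; have s_gt0 : 0 < s by exact: lt_trans (t_gt0 k) ks.
have /andP[ks' sk'] := block_ofP s_gt0.
apply/eqP; rewrite eq_le; apply/andP; split; rewrite leNgt; apply/negP => kl.
  have : t (k + 1) <= t (block_of s) by apply: level_time_le; rewrite lezD1.
  by rewrite leNgt (lt_le_trans ks' sk).
have : t (block_of s + 1) <= t k by apply: level_time_le; rewrite lezD1.
by rewrite leNgt (lt_le_trans ks sk').
Qed.

Lemma blockE k : D `&` block_of @^-1` [set k] = block k.
Proof.
apply/seteqP; split => s.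
  by rewrite /D /block /= !in_itv/= andbT => -[s_gt0 <-]; exact: block_ofP.
rewrite /D /block /= !in_itv/= andbT => /andP[ks sk].
by split; [exact: lt_trans (t_gt0 k) ks|exact: block_of_unique].
Qed.

Lemma mem_block s k : 0 < s -> (block k s <-> block_of s = k).
Proof.
move=> s_gt0; rewrite -blockE; split => [[]//|ks]; split => //.
by rewrite /D/= in_itv/= s_gt0.
Qed.

(** The union of the blocks number -n to n - 1, which increases to the
    half-line. *)
Definition window (n : nat) : set R := [set s | - n%:Z <= block_of s < n%:Z].

Lemma windowE n : D `&` window n = `]t (- n%:Z), t n%:Z]%classic.
Proof.
apply/seteqP; split => s; rewrite /D /window /= !in_itv/= andbT.
  move=> [s_gt0 /andP[nk kn]]; have /andP[ks sk] := block_ofP s_gt0.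
  by rewrite (le_lt_trans (level_time_le nk) ks) (le_trans sk)// level_time_le// lezD1.
move=> /andP[ns sn]; have s_gt0 : 0 < s by exact: lt_trans (t_gt0 _) ns.
split => //; have /andP[ks sk] := block_ofP s_gt0; apply/andP; split.
  rewrite -ltzD1 ltNge; apply/negP => /level_time_le.
  by rewrite leNgt (lt_le_trans ns sk).
rewrite ltNge; apply/negP => /level_time_le.
by rewrite leNgt (lt_le_trans ks sn).
Qed.

Lemma measurable_window n : measurable (D `&` window n).
Proof. by rewrite windowE; exact: measurable_itv. Qed.

Lemma measurable_block k : measurable (block k).
Proof. exact: measurable_itv. Qed.

Lemma window_near s : \forall n \near \oo, window n s.
Proof.
near=> n; rewrite /window/=.
have kn : (`|block_of s| < n)%N by near: n; exact: nbhs_infty_gt.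
lia.
Unshelve. all: by end_near. Qed.

Definition window_indices (n : nat) : seq int :=
  [seq j%:Z - n%:Z | j <- iota 0 (n + n)].

Lemma mem_window_indices n k : (k \in window_indices n) = (- n%:Z <= k < n%:Z).
Proof.
apply/mapP/idP => [[j]|/andP[nk kn]].
  rewrite mem_iota add0n => /andP[_ jn] ->; lia.
exists `|(k + n%:Z)%R|%N; last lia.
rewrite mem_iota; lia.
Qed.

Lemma uniq_window_indices n : uniq (window_indices n).
Proof. by rewrite map_inj_uniq ?iota_uniq// => i j; lia. Qed.

Section simple_approximation.
Variables (n : nat) (h : R -> R).
Hypothesis finh : finite_set (range h).
Hypothesis mh : forall r, measurable (h @^-1` [set r]).

(** The function s |-> h(s) W(block_of s), cut off outside of the window, only
    depends on the pair (block_of s, h(s)), which takes finitely many values. The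
    pair (0, 0) marks the points outside of the window. *)
Definition label (s : R) : int * R :=
  if - n%:Z <= block_of s < n%:Z then (block_of s, h s) else (0, 0).

Lemma label_level i : D `&` label @^-1` [set i] =
  (if - n%:Z <= i.1 < n%:Z then block i.1 `&` h @^-1` [set i.2] else set0) `|`
  (if i == (0, 0) then D `\` (D `&` window n) else set0).
Proof.
case: i => k r /=; rewrite -blockE /label; apply/seteqP; split => s /=.
  move=> [Ds]; case: ifPn => [nkn [<- <-]|nkn [<- <-]]; first by left; rewrite nkn.
  by right; rewrite eqxx; split => // -[_]; rewrite /window/= (negbTE nkn).
case; case: ifPn => // nkn.
  by move=> [[Ds ksk] <-]; split => //; rewrite ksk nkn.
move: nkn => /eqP [-> ->] [Ds nin]; split => //.
by case: ifPn => // nkn; exfalso; apply: nin.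
Qed.

Lemma measurable_label i : measurable (D `&` label @^-1` [set i]).
Proof.
rewrite label_level; apply: measurableU; case: ifP => // _.
  by apply: measurableI => //; exact: measurable_block.
by apply: measurableD; [exact: measurable_itv|exact: measurable_window].
Qed.

Lemma finite_label : finite_set (label @` D).
Proof.
apply: (@sub_finite_set _ _ (([set` window_indices n] `*` range h) `|` [set (0, 0)])).
  move=> _ [s Ds <-]; rewrite /label; case: ifPn => nkn; [left|by right].
  by split => //=; [rewrite mem_window_indices|exists s].
rewrite finite_setU; split; last exact: finite_set1.
by apply: finite_setX => //; exact: finite_seq.
Qed.

Variables (Z : lmodType R) (W : int -> Z).

Definition labelled (i : int * R) : Z := i.2 *: W i.1.

Lemma label_lty i : labelled i != 0 -> (lambda (D `&` label @^-1` [set i]) < +oo)%E.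
Proof.
move=> i0; apply: (@le_lt_trans _ _ (lambda (D `&` window n))).
  have ml := measurable_label i; have mi := measurable_window n.
  apply: le_measure; [exact: mem_set|exact: mem_set|].
  move=> s [Ds /=]; rewrite /label; case: ifPn => // _ ik.
  by move: i0; rewrite -ik /labelled/= scale0r eqxx.
rewrite windowE lebesgue_measure_itv/=; case: ifP => // _.
by rewrite -EFinD ltry.
Qed.

Definition approximant : R -> Z := labelled \o label.

Lemma approximant_simple (E : nspace Z) : seminormed E -> (forall k, carrier E (W k)) ->
  simple_on D E approximant.
Proof.
move=> sE EW; split.
- by move=> _ [s _ <-]; exact: carrierZ.
- by rewrite /approximant -image_comp; apply: finite_image; exact: finite_label.
- by move=> z; exact: (measurable_finite_valued finite_label measurable_label (labelled @^-1` [set z])).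
Qed.

Lemma approximantE s : window n s -> approximant s = h s *: W (block_of s).
Proof. by rewrite /window /approximant /label /labelled/= => ->. Qed.

Lemma approximant_out s : ~ window n s -> approximant s = 0.
Proof.
by rewrite /window /approximant /label /labelled/= => /negP/negbTE ->; rewrite scale0r.
Qed.

Lemma approximant_lty z : z != 0 -> (lambda (D `&` approximant @^-1` [set z]) < +oo)%E.
Proof.
apply: level_comp_lty; [exact: finite_label|exact: measurable_label|exact: label_lty].
Qed.

Lemma integral_block k : (forall s, 0 <= h s) ->
  (\int[lambda]_(s in block k) (h s)%:E =
   \sum_(r \in range h) (r%:E * lambda (block k `&` h @^-1` [set r])))%E.
Proof.
move=> h0.
have mbl := measurable_block k.
transitivity (\int[lambda]_(s in block k) (\sum_(r \in range h)
    (r%:E * (\1_(block k `&` h @^-1` [set r]) s)%:E)))%E.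
  apply: eq_integral => s /set_mem ks; have hs : range h (h s) by exists s.
  rewrite (fsbigD1 (h s))//= fsbig1 ?adde0.
    by rewrite indicE mem_set// mule1.
  move=> r [_ hsr]; rewrite indicE memNset ?mule0// => -[_ /= sr].
  by apply: hsr; rewrite /= sr.
have mind r : measurable (block k `&` h @^-1` [set r]) by exact: measurableI.
rewrite ge0_integral_fsum//; last 2 first.
- by move=> r; apply: measurable_funeM; apply/measurable_EFinP; apply: measurable_indic; exact: mind.
- move=> r s _; rewrite indicE; case: (boolP (s \in _)) => [/set_mem[_ /= <-]|_].
    by rewrite mule1 lee_fin.
  by rewrite mule0.
apply: eq_fsbigr => r /set_mem[s _ <-].
rewrite ge0_integralZl//.
- rewrite integral_indic; [by rewrite setIAC setIid|exact: mbl|exact: mind].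
- by apply/measurable_EFinP; apply: measurable_indic; exact: mind.
- by rewrite lee_fin.
Qed.
End simple_approximation.
End blocks.

Section integral_approximant.
Variables (R : realType) (t : int -> R) (block_of : R -> int).
Hypothesis t_gt0 : forall k, 0 < t k.
Hypothesis t_lt : forall k l : int, k < l -> t k < t l.
Hypothesis block_ofP : forall s, 0 < s -> t (block_of s) < s <= t (block_of s + 1).
Local Notation lambda := (@lebesgue_measure R).
Let D := (`]0, +oo[%classic : set R).
Variables (n : nat) (h : R -> R).
Hypothesis finh : finite_set (range h).
Hypothesis mh : forall r, measurable (h @^-1` [set r]).
Hypothesis h0 : forall s, 0 <= h s.
Variables (Z : lmodType R) (W : int -> Z).

Let block_lty k r : (lambda (block t k `&` h @^-1` [set r]) < +oo)%E.
Proof.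
apply: (@le_lt_trans _ _ (lambda (block t k))).
  have mb := measurable_block t k.
  have mbh : measurable (block t k `&` h @^-1` [set r]) by exact: measurableI.
  by apply: le_measure; [exact: mem_set|exact: mem_set|exact: subIsetl].
rewrite /block lebesgue_measure_itv/=; case: ifP => // _.
by rewrite -EFinD ltry.
Qed.

(** The partition by labels is summed first over the values of [h] in a given
    block. *)
Lemma simple_integral_approximant :
  simple_integral lambda D (approximant block_of n h W) =
  \sum_(k <- window_indices n)
    fine (\int[lambda]_(s in block t k) (h s)%:E)%E *: W k.
Proof.
rewrite /approximant (simple_integral_comp (mu := lambda)
  (finite_label block_of n finh) (measurable_label t_gt0 t_lt block_ofP n mh)
  (label_lty t_gt0 t_lt block_ofP n mh (W := W))).
pose G (i : int * R) := fine (lambda (D `&` label block_of n h @^-1` [set i])) *: labelled W i.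
rewrite -/D.
transitivity (\sum_(i \in [set` window_indices n] `*` range h) G i).
  (* Labels that are not attained have preimages of measure 0, and (0, 0)
     stands for the vector 0. *)
  pose U := (label block_of n h @` D) `|` ([set` window_indices n] `*` range h).
  transitivity (\sum_(i \in U) G i).
    apply: fsbig_widen; first exact: subsetUl.
    move=> i [_ iD] /=; rewrite /G (_ : D `&` _ = set0) ?measure0 ?scale0r//.
    by apply/seteqP; split => // s [Ds /= si]; apply: iD; exists s.
  apply/esym; apply: fsbig_widen; first exact: subsetUr.
  move=> i [[[s Ds <-]|//] iN] /=.
  rewrite /G /label; case: ifPn => nkn; last by rewrite /labelled scale0r scaler0.
  exfalso; apply: iN; rewrite /label nkn; split => /=; last by exists s.
  by rewrite mem_window_indices.
pose G2 k r := G (k, r).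
transitivity (\sum_(i \in [set` window_indices n] `*` range h) G2 i.1 i.2).
  by apply: eq_fsbigr => -[k r].
rewrite -pair_fsbig//=.
rewrite [RHS]fsbig_seq ?uniq_window_indices//.
apply: eq_fsbigr => k /set_mem /=; rewrite mem_window_indices => nkn.
rewrite (integral_block t finh mh k h0) !fsbig_finite//= -sum_fine; last first.
  by move=> r _; rewrite fin_numM// ge0_fin_numE.
rewrite scaler_suml; apply: eq_bigr => r _.
rewrite /G2 /G /labelled/= scalerA; congr (_ *: _).
have [->|r0] := eqVneq r 0; first by rewrite mulr0 mul0e.
rewrite fineM// ?ge0_fin_numE// mulrC; congr (_ * fine (lambda _)).
rewrite (label_level t_gt0 t_lt block_ofP)/= nkn.
by case: eqP => [[_ r00]|_]; rewrite ?setU0//; rewrite r00 eqxx in r0.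
Qed.
End integral_approximant.

Import HBNNSimple.

Lemma simple_minorants (R : realType) (D : set R) (g : R -> R) :
  measurable D -> measurable_fun D g -> (forall s, D s -> 0 <= g s) ->
  exists h : nat -> R -> R,
    [/\ forall n, finite_set (range (h n)),
        forall n r, measurable (h n @^-1` [set r]),
        forall n, measurable_fun setT (h n),
        forall n s, 0 <= h n s &
        forall s, D s -> (forall n, h n s <= g s) /\ h n s @[n --> \oo] --> g s].
Proof.
move=> mD mg g0.
have mgE : measurable_fun D (EFin \o g) by exact/measurable_EFinP.
pose h := nnsfun_approx mD mgE.
exists (fun n => h n : R -> R); split => // s Ds.
have hs : h n s @[n --> \oo] --> g s.
  apply: (fine_cvg (f := fun n => (h n s)%:E)).
  by apply: (cvg_nnsfun_approx mD mgE) => // x Dx; rewrite lee_fin g0.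
split => // n; rewrite -(cvg_lim _ hs)//; apply: nondecreasing_cvgn_le.
  by move=> i j ij; have /lefP := nd_nnsfun_approx mD mgE ij; exact.
by apply/cvg_ex; exists (g s).
Qed.

Section block_function.
Variables (R : realType) (Z : lmodType R) (E0 E1 : nspace Z).
Hypotheses (s0 : seminormed E0) (s1 : seminormed E1).
Variables (phi psi : R -> R) (C : R).
Hypothesis P : increasing_primitive phi psi.
Hypothesis G : sqrt_growth C phi.
Variables (t : int -> R) (block_of : R -> int) (W : int -> Z) (M : R) (f : Z).
Hypothesis M_ge0 : 0 <= M.
Hypothesis t_gt0 : forall k, 0 < t k.
Hypothesis t_lt : forall k l : int, k < l -> t k < t l.
Hypothesis block_ofP : forall s, 0 < s -> t (block_of s) < s <= t (block_of s + 1).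
Hypothesis phit : forall k, phi (t k) = 2 ^ k.
Hypothesis Wcap : forall k, carrier (cap_space E0 E1) (W k).
Hypothesis WJ : forall k s, 0 < s -> s <= t (k + 1) ->
  (Jfun E0 E1 (W k) s <= M%:E)%E.
Hypothesis Wsum : nrm (sum_space E0 E1)
  (f - \sum_(k <- window_indices n) 2 ^ k *: W k) @[n --> \oo] --> 0%E.
Local Notation lambda := (@lebesgue_measure R).
Let D := (`]0, +oo[%classic : set R).
Let mD : measurable D. Proof. exact: measurable_itv. Qed.
Let psi0 := density_ge0 P.
Let mpsi := density_measurable P.
Let sS := sum_seminormed s0 s1.
Let sC := cap_seminormed s0 s1.

Let D_gt0 s : D s -> 0 < s. Proof. by rewrite /D/= in_itv/= andbT. Qed.

(** The scalar factor is approximated by simple functions, inside larger and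
    larger windows. *)
Lemma block_function_strongly_measurable (E : nspace Z) (g : R -> R) (v : R -> Z) :
  seminormed E -> (forall k, carrier E (W k)) ->
  measurable_fun D g -> (forall s, D s -> 0 <= g s) ->
  (forall s, D s -> v s = g s *: W (block_of s)) ->
  strongly_measurable lambda D E v.
Proof.
move=> sE WE mg g0 vE.
split; first by move=> _ [s Ds <-]; rewrite vE//; exact: (carrierZ _ sE (WE _)).
have [h [fh mh _ h0 hg]] := simple_minorants mD mg g0.
exists (fun n => approximant block_of n (h n) W); split.
  by move=> n; exact: (approximant_simple t_gt0 t_lt block_ofP n (fh n) (mh n) sE WE).
apply: aeW => s Ds; have s_gt0 := D_gt0 Ds.
have [_ hs] := hg s Ds.
have fin : nrm E (W (block_of s)) \is a fin_num.
  by rewrite ge0_fin_numE; [exact/(nrm_ltyP sE)|exact: (nrm_ge0 sE)].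
have cv : (`|g s - h n s|%:E * nrm E (W (block_of s)))%E @[n --> \oo] --> 0%E.
  rewrite -(mul0e (nrm E (W (block_of s)))); apply: cvgeZr => //.
  apply: cvg_EFin; first exact: nearW.
  rewrite -[X in _ --> X](normr0 R); apply: cvg_norm.
  rewrite -[X in _ --> X](subrr (g s)).
  by apply: cvgB => //; exact: cvg_cst.
apply: cvg_trans cv; apply: near_eq_cvg.
near=> n; rewrite approximantE; last by near: n; exact: (window_near block_of s).
by rewrite vE// -scalerBl (nrm_scale sE).
Unshelve. all: by end_near. Qed.

Lemma integral_density_block k :
  (\int[lambda]_(s in block t k) (psi s)%:E = (2 ^ k)%:E)%E.
Proof.
rewrite /block (integral_density P) ?(ltW (t_gt0 _))//; last first.
  by apply/ltW/t_lt; rewrite ltrDl.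
by rewrite !phit; congr EFin; rewrite expfzDr// expr1z; ring.
Qed.

(** In the sum, the norm is K(., 1), which is at most min(1, 1 / s) J(., s). *)
Lemma nrm_block_le s : 0 < s ->
  (nrm (sum_space E0 E1) (W (block_of s)) <= (M * Num.min 1 (1 / s))%:E)%E.
Proof.
move=> s_gt0; rewrite sum_nrmE.
apply: (le_trans (Kfun_le_J s0 s1 s_gt0 ltr01 (Wcap _))).
rewrite [M * _]mulrC EFinM; apply: lee_wpmul2l.
  by rewrite lee_fin le_min ler01 divr_ge0// ltW.
by apply: WJ => //; case/andP: (block_ofP s_gt0).
Qed.

Let WS k : carrier (sum_space E0 E1) (W k).
Proof.
exists (W k, 0); split => /=; [by case: (Wcap k)|exact: carrier0|by rewrite addr0].
Qed.

Section bochner.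
Variable h : nat -> R -> R.
Hypothesis fh : forall n, finite_set (range (h n)).
Hypothesis mh : forall n r, measurable (h n @^-1` [set r]).
Hypothesis mhT : forall n, measurable_fun setT (h n).
Hypothesis h0 : forall n s, 0 <= h n s.
Hypothesis hpsi : forall s, D s ->
  (forall n, h n s <= psi s) /\ h n s @[n --> \oo] --> psi s.

(** A measurable majorant of the norm of the error made by the n-th simple
    approximant. It is dominated by a multiple of the kernel
    min(1, 1 / s) psi(s). *)
Definition gap (n : nat) (s : R) : R :=
  (psi s - h n s * \1_(D `&` window block_of n) s) * (M * Num.min 1 (1 / s)).

Let min0 s : D s -> 0 <= M * Num.min 1 (1 / s).
Proof. by move=> /D_gt0 s_gt0; rewrite mulr_ge0// le_min ler01 divr_ge0// ltW. Qed.

Lemma gap_ge0 n s : D s -> 0 <= gap n s.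
Proof.
move=> Ds; rewrite mulr_ge0 ?min0// subr_ge0 indicE.
case: (s \in _); first by rewrite mulr1; exact: (hpsi Ds).1.
by rewrite mulr0.
Qed.

Lemma gap_le n s : D s -> gap n s <= M * (Num.min 1 (1 / s) * psi s).
Proof.
move=> Ds.
have -> : M * (Num.min 1 (1 / s) * psi s) = psi s * (M * Num.min 1 (1 / s)) by ring.
by rewrite ler_wpM2r ?min0// gerBl mulr_ge0.
Qed.

Lemma measurable_gap n : measurable_fun D (gap n).
Proof.
have mi : measurable (D `&` window block_of n) by exact: measurable_window t_gt0 t_lt block_ofP n.
apply: measurable_funM; last first.
  apply: measurable_funM => //; apply: measurable_minr => //.
  by apply: measurable_funM => //; exact: measurable_inv_pos.
apply: measurable_funB; first exact: measurable_funTS.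
by apply: measurable_funM; [exact: measurable_funTS|exact: measurable_indic].
Qed.

Lemma gap_cvg0 s : D s -> gap n s @[n --> \oo] --> 0.
Proof.
move=> Ds; have [_ hs] := hpsi Ds.
have cv : (psi s - h n s) * (M * Num.min 1 (1 / s)) @[n --> \oo] -->
    (psi s - psi s) * (M * Num.min 1 (1 / s)).
  by apply: cvgMr_tmp; apply: cvgB => //; exact: cvg_cst.
rewrite subrr mul0r in cv.
apply: cvg_trans cv; apply: near_eq_cvg; near=> n.
rewrite /gap indicE mem_set ?mulr1//; split => //.
by near: n; exact: (window_near block_of s).
Unshelve. all: by end_near. Qed.

Lemma integral_gap_cvg0 : (\int[lambda]_(s in D) (gap n s)%:E)%E @[n --> \oo] --> 0%E.
Proof.
have k0 s : D s -> 0 <= M * (Num.min 1 (1 / s) * psi s).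
  by move=> Ds; rewrite mulrA mulr_ge0 ?min0.
have mk : measurable_fun D (fun s => M * (Num.min 1 (1 / s) * psi s)).
  by apply: measurable_funM => //; exact: (measurable_kernel P).
have [|||||_ _] := @dominated_convergence _ _ R lambda D mD
  (fun n s => (gap n s)%:E) (cst 0%E) (fun s => (M * (Num.min 1 (1 / s) * psi s))%:E).
- by move=> n; apply/measurable_EFinP; exact: measurable_gap.
- exact: measurable_cst.
- apply: aeW => s Ds; apply: cvg_EFin; first exact: nearW.
  exact: gap_cvg0.
- apply/integrableP; split; first exact/measurable_EFinP.
  rewrite (_ : (\int[lambda]_(x in D) _)%E =
    (\int[lambda]_(s in D) (M%:E * (Num.min 1 (1 / s) * psi s)%:E))%E); last first.
    by apply: eq_integral => s /set_mem Ds; rewrite gee0_abs ?lee_fin ?k0// EFinM.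
  rewrite ge0_integralZl//; last 2 first.
  + by apply/measurable_EFinP; exact: (measurable_kernel P).
  + move=> s /D_gt0 s_gt0; rewrite lee_fin mulr_ge0// le_min ler01 divr_ge0// ltW//.
  rewrite lte_mul_pinfty ?lee_fin//.
  by apply: le_lt_trans (integral_kernel P G ltr01) _; rewrite ltry.
- apply: aeW => s n Ds; rewrite gee0_abs ?lee_fin ?gap_ge0//; exact: gap_le.
by rewrite integral0.
Qed.

Lemma nrm_sub_approximant_le n s : D s ->
  (nrm (sum_space E0 E1) (psi s *: W (block_of s) - approximant block_of n (h n) W s) <=
   (gap n s)%:E)%E.
Proof.
move=> Ds; have s_gt0 := D_gt0 Ds.
have -> : psi s *: W (block_of s) - approximant block_of n (h n) W s =
    (psi s - h n s * \1_(D `&` window block_of n) s) *: W (block_of s).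
  rewrite indicE; have [ins|ins] := pselect (window block_of n s).
    by rewrite approximantE// mem_set// mulr1 scalerBl.
  by rewrite approximant_out// memNset ?mulr0 ?subr0// => -[].
have e0 : 0 <= psi s - h n s * \1_(D `&` window block_of n) s.
  rewrite subr_ge0 indicE; case: (s \in _); first by rewrite mulr1; exact: (hpsi Ds).1.
  by rewrite mulr0.
rewrite (nrm_scale sS) /gap EFinM ger0_norm//.
by apply: lee_wpmul2l; [rewrite lee_fin|exact: nrm_block_le].
Qed.

(** On each block of the window, the missing mass is the integral of psi - h,
    and it is weighted by the norm of a fixed vector; this is at most the
    integral of the gap over the block. *)
Lemma nrm_simple_integral_approximant_le n :
  (nrm (sum_space E0 E1) (f - simple_integral lambda D (approximant block_of n (h n) W)) <=
   nrm (sum_space E0 E1) (f - \sum_(k <- window_indices n) 2 ^ k *: W k) +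
   \int[lambda]_(s in D) (gap n s)%:E)%E.
Proof.
have mb k : measurable (block t k) by exact: measurable_block.
have bD k : block t k `<=` D.
  by rewrite -(blockE t_gt0 t_lt block_ofP); exact: subIsetl.
have mgapE : measurable_fun D (fun s => (gap n s)%:E).
  by apply/measurable_EFinP; exact: measurable_gap.
have gap0 s : D s -> (0 <= (gap n s)%:E)%E by move=> Ds; rewrite lee_fin gap_ge0.
pose a k := (\int[lambda]_(s in block t k) (h n s)%:E)%E.
have piece k : k \in window_indices n ->
    (nrm (sum_space E0 E1) ((2 ^ k - fine (a k)) *: W k) <=
     \int[lambda]_(s in block t k) (gap n s)%:E)%E.
  rewrite mem_window_indices => kn.
  pose r := (\int[lambda]_(s in block t k) (psi s - h n s)%:E)%E.
  have mhb : measurable_fun (block t k) (h n) by exact: measurable_funTS.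
  have mpb : measurable_fun (block t k) psi by exact: measurable_funTS.
  have ph0 s : block t k s -> 0 <= psi s - h n s.
    by move=> /bD Ds; rewrite subr_ge0; exact: (hpsi Ds).1.
  (* Splitting the mass 2^k of the block into the part covered by h and the
     missing part. *)
  have ar : (a k + r = (2 ^ k)%:E)%E.
    rewrite -integral_density_block -ge0_integralD//.
    - by apply: eq_integral => s _; rewrite -EFinD addrC subrK.
    - exact: mb.
    - by move=> s _; rewrite lee_fin.
    - exact/measurable_EFinP.
    - by apply/measurable_EFinP; exact: measurable_funB.
  have a0 : (0 <= a k)%E by apply: integral_ge0 => s _; rewrite lee_fin.
  have r0 : (0 <= r)%E by apply: integral_ge0 => s bs; rewrite lee_fin ph0.
  have afin : a k \is a fin_num.
    by rewrite ge0_fin_numE// (@le_lt_trans _ _ (2 ^ k)%:E) ?ltry// -ar leeDl.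
  have rfin : r \is a fin_num.
    by rewrite ge0_fin_numE// (@le_lt_trans _ _ (2 ^ k)%:E) ?ltry// -ar leeDr.
  have -> : 2 ^ k - fine (a k) = fine r.
    apply: EFin_inj; rewrite EFinB -ar (fineK afin) (fineK rfin).
    by rewrite addeAC subee// add0e.
  rewrite (nrm_scale sS) ger0_norm ?fine_ge0// (fineK rfin).
  have Wfin : nrm (sum_space E0 E1) (W k) \is a fin_num.
    by rewrite ge0_fin_numE; [exact/(nrm_ltyP sS)|exact: (nrm_ge0 sS)].
  rewrite /r -ge0_integralZr//; last 3 first.
  - exact: mb.
  - by apply/measurable_EFinP; exact: measurable_funB.
  - exact: (nrm_ge0 sS).
  apply: ge0_le_lower_integral.
    by move=> s bs; rewrite mule_ge0 ?lee_fin ?ph0//; exact: (nrm_ge0 sS).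
  move=> s bs; have Ds := bD k s bs; have s_gt0 := D_gt0 Ds.
  have ks : block_of s = k by exact: ((mem_block t_gt0 t_lt block_ofP k s_gt0).1 bs).
  have ins : window block_of n s by rewrite /window/= ks.
  rewrite /gap indicE mem_set// mulr1 EFinM.
  apply: lee_wpmul2l; first by rewrite lee_fin ph0.
  by rewrite -ks; exact: nrm_block_le.
have -> : f - simple_integral lambda D (approximant block_of n (h n) W) =
    (f - \sum_(k <- window_indices n) 2 ^ k *: W k) +
    \sum_(k <- window_indices n) (2 ^ k - fine (a k)) *: W k.
  rewrite (simple_integral_approximant t_gt0 t_lt block_ofP n (fh n) (mh n) (h0 n)).
  under [X in _ = _ + X]eq_bigr do rewrite scalerBl.
  by rewrite sumrB addrA subrK.
apply: le_trans (nrm_add sS _ _) _; apply: leeD => //.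
apply: le_trans (nrm_sum_seq _ _ sS) _.
apply: (@le_trans _ _ (\sum_(k <- window_indices n)
    \int[lambda]_(s in block t k) (gap n s)%:E)%E).
  by rewrite big_seq [leRHS]big_seq; apply: lee_sum => k; exact: piece.
have UD : \big[setU/set0]_(k <- window_indices n) block t k `<=` D.
  by rewrite -bigcup_seq => s [k _ /bD].
rewrite -ge0_integral_bigsetU//.
- apply: ge0_subset_integral => //.
  by apply: bigsetU_measurable => k _; exact: mb.
- exact: uniq_window_indices.
- move=> k l _ _ [s [sk sl]].
  have s_gt0 := D_gt0 (bD _ _ sk).
  rewrite -((mem_block t_gt0 t_lt block_ofP k s_gt0).1 sk).
  exact: ((mem_block t_gt0 t_lt block_ofP l s_gt0).1 sl).
- exact: measurable_funS mgapE.
- by move=> s /UD; exact: gap0.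
Qed.

End bochner.

Lemma block_function_bochner (v : R -> Z) : carrier (sum_space E0 E1) f ->
  (forall s, D s -> v s = psi s *: W (block_of s)) ->
  is_bochner_integral lambda D (sum_space E0 E1) v f.
Proof.
move=> fS vE.
have mpsiD : measurable_fun D psi by exact: measurable_funTS.
have [h [fh mh mhT h0 hpsi]] := simple_minorants mD mpsiD (fun s _ => psi0 s).
split => //.
  exact: (block_function_strongly_measurable sS WS mpsiD (fun s _ => psi0 s)).
exists (fun n => approximant block_of n (h n) W); split.
- by move=> n; exact: (approximant_simple t_gt0 t_lt block_ofP n (fh n) (mh n) sS WS).
- by move=> n z z0; exact: (approximant_lty t_gt0 t_lt block_ofP n (fh n) (mh n) W z0).
- have cv := integral_gap_cvg0 mhT h0 hpsi.
  apply: squeeze_cvge; last 2 first; [exact: cvg_cst|exact: cv|].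
  apply: nearW => n; apply/andP; split.
    by apply: integral_ge0 => s _; exact: (nrm_ge0 sS).
  apply: ge0_le_lower_integral; first by move=> s _; exact: (nrm_ge0 sS).
  by move=> s Ds; rewrite vE//; exact: nrm_sub_approximant_le.
- have cv := cvgeD (isT : (0 : \bar R) +? 0)%E Wsum (integral_gap_cvg0 mhT h0 hpsi).
  rewrite adde0 in cv.
  apply: squeeze_cvge; last 2 first; [exact: cvg_cst|exact: cv|].
  apply: nearW => n; apply/andP; split; first exact: (nrm_ge0 sS).
  exact: nrm_simple_integral_approximant_le.
Qed.

Lemma block_function_represents : carrier (sum_space E0 E1) f ->
  represents E0 E1 (fun s => (s * psi s) *: W (block_of s)) f.
Proof.
move=> fS; split.
  apply: (block_function_strongly_measurable (g := fun s => s * psi s)) => //.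
    by apply: measurable_funM => //; exact: measurable_funTS.
  by move=> s /D_gt0 s_gt0; rewrite mulr_ge0// ltW.
apply: block_function_bochner => // s /D_gt0 s_gt0.
by rewrite scalerA mulrA mulVf ?mul1r// gt_eqF.
Qed.
End block_function.

(** * From K to J *)

Section K_to_J.
Variables (R : realType) (Z : lmodType R) (E0 E1 : nspace Z).
Hypotheses (s0 : seminormed E0) (s1 : seminormed E1).
Variables (phi psi : R -> R) (C : R).
Hypothesis P : increasing_primitive phi psi.
Hypothesis G : sqrt_growth C phi.
Hypothesis phi_range : forall y, 0 < y -> exists2 t, 0 < t & phi t = y.

Lemma level_times : exists t : int -> R,
  [/\ forall k, 0 < t k, forall k, phi (t k) = 2 ^ k &
      forall k l : int, k < l -> t k < t l].
Proof.
have /choice[t tP] (k : int) : exists t, 0 < t /\ phi t = 2 ^ k.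
  by have [|x x0 xE] := @phi_range (2 ^ k); [rewrite exprz_gt0|exists x].
exists t; split; [by move=> k; case: (tP k)|by move=> k; case: (tP k)|].
move=> k l kl; rewrite ltNge; apply/negP => /(primitive_nd P).
rewrite (tP k).2 (tP l).2 leNgt => /negP; apply.
by rewrite ltr_eXz2l// ltr1n.
Qed.

(** The smallest index k with s <= t (k + 1) exists because the values 2^k of
    [phi] range from 0 to oo. *)
Lemma level_index (t : int -> R) : (forall k, phi (t k) = 2 ^ k) ->
  exists block_of : R -> int, forall s, 0 < s -> t (block_of s) < s <= t (block_of s + 1).
Proof.
move=> phit.
suff /choice[block_of block_ofP] (s : R) : exists k, 0 < s -> t k < s <= t (k + 1) by exists block_of.
have [s_le0|s_gt0] := leP s 0; first by exists 0.
have ps := primitive_gt0 P s_gt0.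
have lo k : 2 ^ k < phi s -> t k < s.
  move=> ks; rewrite ltNge; apply/negP => /(primitive_nd P).
  by rewrite phit leNgt ks.
have hi k : phi s < 2 ^ k -> s <= t k.
  move=> ks; rewrite leNgt; apply/negP => /ltW/(primitive_nd P).
  by rewrite phit leNgt ks.
pose n := maxn (Num.bound (phi s)) (Num.bound (phi s)^-1).
have big (x : R) (m : nat) : 0 <= x -> (Num.bound x <= m)%N -> x < 2 ^+ m.
  move=> x0 xm; apply: lt_le_trans (archi_boundP x0) _.
  by rewrite -natrX ler_nat (leq_trans xm)// ltnW// ltn_expl.
have sn : s <= t n%:Z.
  by apply: hi; apply: big; [exact: ltW|exact: leq_maxl].
have ns : t (- n%:Z) < s.
  apply: lo; rewrite -exprnN invf_plt ?posrE ?exprn_gt0//.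
  by apply: big; [rewrite invr_ge0 ltW|exact: leq_maxr].
have ex : exists m : nat, s <= t (m%:Z - n%:Z).
  by exists (n + n)%N; rewrite PoszD addrK.
case: (ex_minnP ex) => -[|m] sm mmin.
  by move: sm; rewrite sub0r leNgt ns.
exists (m%:Z - n%:Z) => _; apply/andP; split.
  rewrite ltNge; apply/negP => /mmin; by rewrite ltnn.
by rewrite addrAC -[m%:Z + 1]/(m%:Z + 1%:Z) -PoszD addn1.
Qed.

Variables (f : Z) (N : R).
Hypothesis N_gt0 : 0 < N.
Hypothesis fS : carrier (sum_space E0 E1) f.
Hypothesis Kf : forall t, 0 < t -> (Kfun E0 E1 f t < (N * phi t)%:E)%E.

Lemma Kfun_decomposition t : 0 < t -> exists p : (Z * Z) * (R * R),
  [/\ carrier E0 p.1.1 /\ carrier E1 p.1.2, f = p.1.1 + p.1.2,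
      nrm E0 p.1.1 = p.2.1%:E /\ nrm E1 p.1.2 = p.2.2%:E,
      0 <= p.2.1 /\ 0 <= p.2.2 & p.2.1 + t * p.2.2 < N * phi t].
Proof.
move=> t0; have [f0 [f1 [c0 c1 fE]]] := Kfun_lt (Kf t0).
have n0 : nrm E0 f0 \is a fin_num.
  by rewrite ge0_fin_numE ?nrm_ge0//; apply/nrm_ltyP.
have n1 : nrm E1 f1 \is a fin_num.
  by rewrite ge0_fin_numE ?nrm_ge0//; apply/nrm_ltyP.
rewrite -(fineK n0) -(fineK n1) -EFinM -EFinD lte_fin => H.
exists ((f0, f1), (fine (nrm E0 f0), fine (nrm E1 f1))) => /=; split => //.
- by rewrite !fineK.
- by rewrite !fine_ge0 ?nrm_ge0.
Qed.

(** On the block ]t_k, t_(k+1)] the vector is 2^-k (f0_(k+2) - f0_(k+1)): the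
    factor 2^-k is the inverse of the integral of psi over the block, and the
    shift of the index makes both decompositions involved almost optimal at
    times not before t_(k+1). *)
Lemma exists_representation : exists w : R -> Z,
  [/\ represents E0 E1 (fun s => (s * psi s) *: w s) f &
      forall s, 0 < s -> (Jfun E0 E1 (w s) s <= (6 * N)%:E)%E].
Proof.
have [t [t_gt0 phit t_lt]] := level_times.
have [block_of block_ofP] := level_index phit.
have /choice[p pP] k := Kfun_decomposition (t_gt0 k).
pose f0 k := (p k).1.1; pose f1 k := (p k).1.2.
pose a k := (p k).2.1; pose b k := (p k).2.2.
have c0 k : carrier E0 (f0 k) by case: (pP k) => -[].
have c1 k : carrier E1 (f1 k) by case: (pP k) => -[].
have fE k : f = f0 k + f1 k by case: (pP k).
have na k : nrm E0 (f0 k) = (a k)%:E by case: (pP k) => _ _ [].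
have nb k : nrm E1 (f1 k) = (b k)%:E by case: (pP k) => _ _ [].
have a0 k : 0 <= a k by case: (pP k) => _ _ _ [].
have b0 k : 0 <= b k by case: (pP k) => _ _ _ [].
have ab k : a k + t k * b k < N * 2 ^ k by case: (pP k) => _ _ _ _; rewrite phit.
have aN k : a k <= N * 2 ^ k.
  by apply/ltW/(le_lt_trans _ (ab k)); rewrite lerDl mulr_ge0// ltW.
have bN k : t k * b k <= N * 2 ^ k.
  by apply/ltW/(le_lt_trans _ (ab k)); rewrite lerDr.
have pow1 (k : int) : 2 ^ (k + 1) = 2 * 2 ^ k :> R.
  by rewrite expfzDr// expr1z mulrC.
have pow_gt0 (k : int) : 0 < 2 ^ k :> R by rewrite exprz_gt0.
pose v k := f0 (k + 2) - f0 (k + 1).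
have v1 k : v k = f1 (k + 1) - f1 (k + 2).
  rewrite /v; apply/eqP; rewrite subr_eq addrAC -subr_eq opprK -fE.
  by rewrite addrC -fE.
pose W k := (2 ^ k)^-1 *: v k.
have Wcap k : carrier (cap_space E0 E1) (W k).
  split; first by apply: carrierZ => //; exact: carrierB.
  by apply: carrierZ => //; rewrite v1; exact: carrierB.
have WJ k s : 0 < s -> s <= t (k + 1) -> (Jfun E0 E1 (W k) s <= (6 * N)%:E)%E.
  move=> s_gt0 sk.
  have k2 : k + 2 = k + 1 + 1 by rewrite -addrA.
  rewrite /Jfun ge_max; apply/andP; split.
    rewrite nrm_scale// gtr0_norm ?invr_gt0//.
    apply: (@le_trans _ _ (((2 ^ k)^-1)%:E * (a (k + 2) + a (k + 1))%:E)%E).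
      apply: lee_wpmul2l; first by rewrite lee_fin invr_ge0 ltW.
      by rewrite EFinD -!na; exact: nrm_sub.
    rewrite -EFinM lee_fin ler_pdivrMl//.
    apply: (le_trans (lerD (aN _) (aN _))).
    by rewrite k2 !pow1 le_eqVlt; apply/orP; left; apply/eqP; ring.
  rewrite nrm_scale// gtr0_norm ?invr_gt0//.
  apply: (@le_trans _ _ (s%:E * (((2 ^ k)^-1)%:E * (b (k + 1) + b (k + 2))%:E))%E).
    apply: lee_wpmul2l; first by rewrite lee_fin ltW.
    apply: lee_wpmul2l; first by rewrite lee_fin invr_ge0 ltW.
    by rewrite v1 EFinD -!nb; exact: nrm_sub.
  rewrite -!EFinM lee_fin mulrCA ler_pdivrMl// mulrDr.
  apply: (@le_trans _ _ (t (k + 1) * b (k + 1) + t (k + 2) * b (k + 2))).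
    apply: lerD; apply: ler_wpM2r => //.
    apply: (le_trans sk); apply/ltW/t_lt.
    by rewrite ltrD2l.
  apply: (le_trans (lerD (bN _) (bN _))).
  by rewrite k2 !pow1 le_eqVlt; apply/orP; left; apply/eqP; ring.
exists (fun s => W (block_of s)); split; last first.
  by move=> s s_gt0; apply: WJ => //; case/andP: (block_ofP s s_gt0).
apply: (block_function_represents s0 s1 P G (M := 6 * N) (t := t)) => //.
  by rewrite mulr_ge0// ltW.
pose c := C * phi 1.
have phi1 := primitive_gt0 P (@ltr01 R).
have c_gt0 : 0 < c by rewrite mulr_gt0// (lt_le_trans ltr01)// (sqrt_growth_ge1 P G).
have bound : \forall n \near \oo, (nrm (sum_space E0 E1)
    (f - \sum_(k <- window_indices n) 2 ^ k *: W k) <=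
    ((2 * N + N * c ^+ 2) * 2^-1 ^+ n)%:E)%E.
  near=> n.
  have -> : \sum_(k <- window_indices n) 2 ^ k *: W k =
      f0 (n%:Z + 1) - f0 (1 - n%:Z).
    rewrite big_map -{1}[(n + n)%N]subn0 -/(index_iota 0 (n + n)).
    under eq_bigr do rewrite /W scalerA mulfV ?gt_eqF// scale1r.
    (* The sum over the window telescopes. *)
    pose g (j : nat) := f0 (j%:Z - n%:Z + 1).
    rewrite (eq_bigr (fun j => g j.+1 - g j)); last first.
      move=> j _; rewrite /v /g; congr (f0 _ - _); lia.
    rewrite telescope_sumr// /g; congr (f0 _ - f0 _); lia.
  have -> : f - (f0 (n%:Z + 1) - f0 (1 - n%:Z)) = f0 (1 - n%:Z) + f1 (n%:Z + 1).
    by rewrite {1}(fE (n%:Z + 1)) opprB addrC addrA subrK.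
  apply: (le_trans (sum_nrm_le (c0 _) (c1 _) erefl)).
  rewrite na nb -EFinD lee_fin mulrDl; apply: lerD.
    apply: (le_trans (aN _)); rewrite expfzDr// expr1z -exprnN exprVn.
    by rewrite mulrA [N * 2]mulrC.
  have n1E : 2 ^ (n%:Z + 1) = 2 ^+ n.+1 :> R by rewrite -[n.+1]addn1.
  pose y : R := 2 ^+ n.+1.
  have y0 : 0 < y by rewrite exprn_gt0.
  (* For large n the growth condition compares phi at t (n + 1) with phi 1 and
     gives t (n + 1) >= (2 ^ n.+1 / c) ^ 2, which makes b (n + 1) small. *)
  have t1 : 1 <= t (n%:Z + 1).
    rewrite leNgt; apply/negP => /ltW/(primitive_nd P).
    rewrite phit n1E leNgt => /negP; apply.
    near: n; exists (Num.bound (phi 1)) => // n /= bn.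
    apply: (lt_le_trans (archi_boundP (ltW (primitive_gt0 P ltr01)))).
    by rewrite -natrX ler_nat (leq_trans bn)// ltnW// (leq_trans _ (ltn_expl n.+1 _)).
  have yt : y ^+ 2 <= c ^+ 2 * t (n%:Z + 1).
    have := G ltr01 t1; rewrite phit n1E divr1 mulrAC -/c -/y => yc.
    rewrite -[t _]sqr_sqrtr ?(ltW (t_gt0 _))// -exprMn ler_pXn2r ?nnegrE//.
      exact: ltW.
    by rewrite mulr_ge0 ?sqrtr_ge0// ltW.
  have tb := bN (n%:Z + 1); rewrite n1E -/y in tb.
  have H : y * (y * b (n%:Z + 1)) <= y * (N * c ^+ 2).
    apply: (@le_trans _ _ (c ^+ 2 * (t (n%:Z + 1) * b (n%:Z + 1)))).
      by rewrite !mulrA -expr2 ler_wpM2r.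
    apply: (@le_trans _ _ (c ^+ 2 * (N * y))); last by rewrite le_eqVlt; apply/orP; left; apply/eqP; ring.
    by rewrite ler_wpM2l// exprn_ge0// ltW.
  rewrite ler_pM2l// in H.
  rewrite exprVn ler_pdivlMr ?exprn_gt0// mulrC.
  apply: le_trans H; apply: ler_wpM2r => //.
  by rewrite /y exprS ler_peMl ?exprn_ge0// ler1n.
have cv : (((2 * N + N * c ^+ 2) * 2^-1 ^+ n)%:E)%E @[n --> \oo] --> 0%E.
  apply: cvg_EFin; first exact: nearW.
  rewrite -[X in _ --> X](mulr0 (2 * N + N * c ^+ 2)).
  apply: cvgMl_tmp; apply: cvg_expr.
  by rewrite ger0_norm ?invr_ge0// invf_lt1// ltr1n.
apply: squeeze_cvge; last 2 first; [exact: cvg_cst|exact: cv|].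
near=> n; apply/andP; split; last by near: n; exact: bound.
exact: (nrm_ge0 (sum_seminormed s0 s1)).
Unshelve. all: by end_near. Qed.
End K_to_J.

Section K_space_J_space.
Variables (R : realType) (Z : lmodType R) (E0 E1 : nspace Z).
Hypotheses (s0 : seminormed E0) (s1 : seminormed E1).
Variables (B phi psi : R -> R) (C : R) (A : R -> \bar R).
Hypothesis P : increasing_primitive phi psi.
Hypothesis G : sqrt_growth C phi.
Hypothesis phi_range : forall y, 0 < y -> exists2 t, 0 < t & phi t = y.
Hypothesis B_pos : forall t, 0 < t -> 0 < B t.
Hypothesis B_ac : locally_abs_continuous B.
Hypothesis phiE : forall t, 0 < t -> phi t = (B t)^-1.
Local Notation lambda := (@lebesgue_measure R).
Hypothesis AE : {ae lambda, forall s, 0 < s -> A s = (((s * psi s)%:E)^-1)%E}.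

(** Valid for every couple: both inequalities are those of
    [represents_Kfun_le] and [exists_representation], read through
    A(s) = 1 / (s psi(s)). *)
Lemma Kspace_Jspace :
  same_space (Kspace E0 E1 (fun t => (B t)%:E)) (Jspace E0 E1 A).
Proof.
have sS := sum_seminormed s0 s1.
have C1 := sqrt_growth_ge1 P G.
have C0 : 0 < C by exact: lt_le_trans C1.
have AJ0 u : {ae lambda, forall s, 0 < s -> (0 <= A s * Jfun E0 E1 (u s) s)%E}.
  move: AE; apply: filterS; first exact: (ae_filter_ringOfSetsType lambda).
  move=> s HE s_gt0; rewrite HE// mule_ge0 ?Jfun_ge0// inve_ge0 lee_fin.
  by rewrite mulr_ge0 ?(density_ge0 P)// ltW.
have BK0 f : {ae lambda, forall t, 0 < t -> (0 <= (B t)%:E * Kfun E0 E1 f t)%E}.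
  apply: aeW => t t0; rewrite mule_ge0 ?lee_fin ?(ltW (B_pos _))//.
  exact: Kfun_ge0.
have J0 f : (0 <= nrm (Jspace E0 E1 A) f)%E.
  by apply: le_ereal_inf_tmp => _ [u _ <-]; exact: Linfty_ge0.
apply: (@same_space_of_le _ _ _ _ (carrier (sum_space E0 E1)) (5 * C) 6) => //.
- by rewrite mulr_gt0.
- move=> f; split => [[cf _ fin]//|[cf fin]]; split => //.
  by have /ereal_inf_lt[_ [u ru <-] _] := fin; exists u.
- by move=> f _; split; [exact: Linfty_ge0|exact: J0].
- move=> f cf; apply: lee_pM_of_real_bounds; first by rewrite mulr_gt0.
  move=> N HN.
  have N0 : 0 < N by rewrite -lte_fin (le_lt_trans (J0 f) HN).
  have [_ [u ru <-] uN] := ereal_inf_lt HN.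
  apply/Linfty_leP => //; first by rewrite lee_fin !mulr_ge0// ltW.
  apply: aeW => t t0.
  have := represents_Kfun_le s0 s1 P G AE (ltW N0) t0 ru (ltW uN).
  rewrite phiE// => H; rewrite -lee_pdivlMl ?B_pos// -EFinM mulrC.
  exact: H.
- move=> f cf; apply: lee_pM_of_real_bounds; first by [].
  move=> N HN.
  have N0 : 0 < N by rewrite -lte_fin; apply: le_lt_trans HN; exact: Linfty_ge0.
  have K0 := Linfty_ge0 (fun t => ((B t)%:E * Kfun E0 E1 f t)%E).
  have [m m0 [mE mN]] : exists2 m : R, 0 <= m &
      nrm (Kspace E0 E1 (fun t => (B t)%:E)) f = m%:E /\ m < N.
    move: K0 HN; rewrite /Kspace/=; case: (Linfty _) => [r| |]//= r0 rN.
    by exists r => //; split.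
  have Hm : {ae lambda, forall s, 0 < s -> ((B s)%:E * Kfun E0 E1 f s <= m%:E)%E}.
    by apply/Linfty_leP => //; rewrite -mE.
  have Kf t : 0 < t -> (Kfun E0 E1 f t < (N * phi t)%:E)%E.
    move=> t0.
    have : ((B t)%:E * Kfun E0 E1 f t <= m%:E)%E.
      apply: (ae_le_everywhere (k := Kfun E0 E1 f)) Hm => //.
        by move=> *; exact: Kfun_mono.
      exact: Kfun_ge0.
    rewrite -lee_pdivlMl ?B_pos// => H; apply: (le_lt_trans H).
    by rewrite -EFinM lte_fin phiE// mulrC ltr_pM2r// invr_gt0 B_pos.
  have [w [rw wJ]] := exists_representation s0 s1 P G phi_range N0 cf Kf.
  apply: (@le_trans _ _ (Linfty (fun s => (A s * Jfun E0 E1 ((s * psi s) *: w s) s)%E))).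
    by apply: ereal_inf_lbound; exists (fun s => (s * psi s) *: w s).
  apply/Linfty_leP => //; first by rewrite lee_fin mulr_ge0// ltW.
  move: AE; apply: filterS; first exact: (ae_filter_ringOfSetsType lambda).
  move=> s HE s_gt0; rewrite HE//.
  have sp0 : 0 <= s * psi s by rewrite mulr_ge0 ?(density_ge0 P)// ltW.
  have -> : Jfun E0 E1 ((s * psi s) *: w s) s =
      ((s * psi s)%:E * Jfun E0 E1 (w s) s)%E.
    rewrite /Jfun !nrm_scale// ger0_norm// maxe_pMr ?lee_fin//.
    by congr (Order.max _ _); rewrite muleCA.
  rewrite inver; case: eqP => [->|/eqP sp].
    by rewrite mul0e mule0 lee_fin mulr_ge0// ltW.
  by rewrite muleA -EFinM mulVf// mul1e; exact: wJ.
Qed.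
End K_space_J_space.

(** * Slowly varying weights *)

Section weights.
Variable R : realType.
Implicit Types b B beta : R -> R.

Lemma sv_almost_increasing B (eps : R) : slowly_varying B -> 0 < eps ->
  exists2 C, 0 < C & forall r s, 0 < r -> r <= s ->
    r `^ eps * B r <= C * (s `^ eps * B s).
Proof.
move=> [_ _ H] e0; have [[g [g0 gnd [C C0 Hg]]] _] := H eps e0.
exists (C * C); first by rewrite mulr_gt0.
move=> r s r0 rs; have s_gt0 : 0 < s by exact: lt_le_trans rs.
apply: (le_trans (Hg r r0).1); rewrite -mulrA ler_pM2l//.
by apply: (le_trans (gnd r s r0 rs)); exact: (Hg s s_gt0).2.
Qed.

Lemma sv_sqrt_growth B : slowly_varying B ->
  exists C, sqrt_growth C (reciprocal_pos B).
Proof.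
move=> svB; have [B0 _ _] := svB.
have [C C0 H] := @sv_almost_increasing B 2^-1 svB ltac:(by rewrite invr_gt0).
exists C => r s r0 rs; have s_gt0 : 0 < s by exact: lt_le_trans rs.
have := H r s r0 rs; rewrite (powR12_sqrt (ltW r0)) (powR12_sqrt (ltW s_gt0)) => {}H.
rewrite !reciprocal_posE// sqrtrM ?(ltW s_gt0)// sqrtrV ?(ltW r0)//.
have r2 : 0 < Num.sqrt r by rewrite sqrtr_gt0.
rewrite -(ler_pM2r (B0 s s_gt0)) mulVf ?gt_eqF ?B0//.
rewrite -(ler_pM2r (mulr_gt0 r2 (B0 r r0))) mul1r.
apply: (le_trans H); rewrite le_eqVlt; apply/orP; left; apply/eqP.
by field; rewrite !gt_eqF ?B0.
Qed.

Lemma sv_mul_bounded B : slowly_varying B ->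
  exists M, forall t, 0 < t -> t <= 1 -> t * B t <= M.
Proof.
move=> svB; have [C C0 H] := @sv_almost_increasing B 1 svB ltr01.
exists (C * (1 * B 1)) => t t0 t1.
by have := H t 1 t0 t1; rewrite powR1 (powRr1 (ltW t0)).
Qed.

(** Continuity of [B] at 1 transfers the monotonicity of the two pieces across
    the junction. *)
Lemma glued_nonincreasing B (b beta : R -> R) (c : R) : 0 < c ->
  nonincreasing_pos b -> nonincreasing_pos beta -> locally_abs_continuous B ->
  (forall x, 1 <= x -> B x = b x) ->
  (forall x, 0 < x -> x < 1 -> B x = c * beta x) ->
  nonincreasing_pos B.
Proof.
move=> c0 db dbeta acB B1 B0.
have lo x y : 0 < x -> x <= y -> y < 1 -> B y <= B x.
  move=> x0 xy y1; rewrite !B0//; last 2 first.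
  - exact: le_lt_trans y1.
  - exact: lt_le_trans xy.
  by rewrite ler_pM2l// dbeta.
have at1 x : 0 < x -> x < 1 -> B 1 <= B x.
  move=> x0 x1; rewrite leNgt; apply/negP => Bx1.
  have /cvgrPdist_lt/(_ (B 1 - B x)) := locally_ac_cvg (@ltr01 R) acB.
  rewrite subr_gt0 => /(_ Bx1)/nbhs_ballP[d /= d0 bd].
  (* A point of [x, 1) that is close to 1. *)
  pose y := Num.max x (1 - d / 2).
  have y1 : y < 1 by rewrite /y gt_max x1/= ltrBlDr ltrDl divr_gt0.
  have xy : x <= y by rewrite /y le_max lexx.
  have yd : 1 - d / 2 <= y by rewrite /y le_max lexx orbT.
  have /bd/= : ball (1 : R) d y by rewrite /ball/= gtr0_norm ?subr_gt0//; lra.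
  by move=> /ltr_normlP[]; have := lo x y x0 xy y1; lra.
move=> x y x0 xy; have [y1|y1] := ltP y 1; first exact: lo.
have [x1|x1] := ltP x 1; last by rewrite !B1//; apply: db.
apply: le_trans (at1 x x0 x1).
by rewrite !B1//; apply: db.
Qed.

Lemma glued_at_zero B (beta : R -> R) (c : R) : 0 < c ->
  nonincreasing_pos beta -> at_zero beta = +oo%E ->
  (forall x, 0 < x -> x < 1 -> B x = c * beta x) ->
  forall M, exists2 d, 0 < d & forall t, 0 < t -> t <= d -> M <= B t.
Proof.
move=> c0 dbeta betaoo B0 M.
have [d d0 H] := at_zero_eqy dbeta betaoo (M / c).
exists (Num.min d (1 / 2)); first by rewrite lt_min d0 divr_gt0.
move=> t t0; rewrite le_min => /andP[td t2].
rewrite B0//; last by lra.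
by rewrite mulrC -ler_pdivrMr// H.
Qed.

(** B' = - psi / phi^2 = - psi B^2. Where psi vanishes both sides are +oo. *)
Lemma reciprocal_weightE B (psi : R -> R) (s : R) : 0 < s ->
  (forall t, 0 < t -> 0 < B t) ->
  derivable (reciprocal_pos B) s 1 -> derive1 (reciprocal_pos B) s = psi s ->
  ((B s ^+ 2)%:E / (s * - derive1 B s)%:E)%E = (((s * psi s)%:E)^-1)%E.
Proof.
move=> s_gt0 B0 dphi ephi.
have phis : reciprocal_pos B s != 0 by rewrite reciprocal_posE// invr_neq0// gt_eqF ?B0.
have dV : is_derive s 1 (reciprocal_pos B) (psi s).
  by apply: DeriveDef => //; rewrite -derive1E.
have [dinv einv] := is_deriveV phis dV.
have [|_ eB] := @near_eq_derive1 R (fun y => (reciprocal_pos B y)^-1) B s _ dinv.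
  near=> y; have y0 : 0 < y by near: y; exact: lt_nbhsr.
  by rewrite reciprocal_posE// invrK.
rewrite eB derive1E einv reciprocal_posE//.
have Bs := B0 s s_gt0.
have -> : s * - (- (B s)^-1 ^- 2 *: psi s) = (s * psi s) * B s ^+ 2.
  by rewrite /GRing.scale/= exprVn invrK; ring.
rewrite !inver mulf_eq0 [_ ^+ 2 == 0]expf_eq0/= [B s == 0]gt_eqF// orbF.
case: eqP => [|/eqP sp]; first by rewrite gt0_muley// lte_fin exprn_gt0.
by rewrite -EFinM invfM mulrC -mulrA mulVf ?mulr1// expf_neq0// gt_eqF.
Unshelve. all: by end_near. Qed.

End weights.

(** * The two identities *)

Theorem theorem1p19 (R : realType)
    (Z : topologicalLmodType R) (Z_hausdorff : hausdorff_space Z)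
    (X0 X1 : completeNormedModType R)
    (i0 : {linear X0 -> Z}) (i1 : {linear X1 -> Z})
    (i0_inj : injective i0) (i0_cont : continuous i0)
    (i1_inj : injective i1) (i1_cont : continuous i1)
    (b beta B : R -> R) (c : R) (A : R -> \bar R)
    (b_SV : slowly_varying b) (b_AC : locally_abs_continuous b)
    (b_decr : strictly_decreasing_pos b)
    (b_zero : (at_zero b < +oo)%E) (b_infty : at_infty b = 0%E)
    (beta_SV : slowly_varying beta) (beta_AC : locally_abs_continuous beta)
    (beta_decr : strictly_decreasing_pos beta)
    (beta_zero : at_zero beta = +oo%E) (beta_infty : at_infty beta = 0%E)
    (c_pos : 0 < c)
    (B_ge1 : forall x : R, 1 <= x -> B x = b x)
    (B_lt1 : forall x : R, 0 < x -> x < 1 -> B x = c * beta x)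
    (B_SV : slowly_varying B) (B_AC : locally_abs_continuous B)
    (A_def : {ae @lebesgue_measure R, forall x : R, 0 < x ->
       A x = ((B x ^+ 2)%:E / (x * - derive1 B x)%:E)%E}) :
  let E0 := embedded i0 in
  let E1 := embedded i1 in
  same_space (Kspace E0 E1 (fun t => (b t)%:E))
             (Kspace E0 (sum_space E0 E1) (fun t => (B t)%:E)) /\
  same_space (Kspace E0 (sum_space E0 E1) (fun t => (B t)%:E))
             (Jspace E0 (sum_space E0 E1) A).
Proof.
move=> E0 E1.
have s0 : seminormed E0 by exact: embedded_seminormed.
have s1 : seminormed E1 by exact: embedded_seminormed.
have [b_gt0 _ _] := b_SV; have [B_gt0 _ _] := B_SV.
have b_ni := strictly_decreasing_nonincreasing b_decr.
have beta_ni := strictly_decreasing_nonincreasing beta_decr.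
have B_ni := glued_nonincreasing c_pos b_ni beta_ni B_AC B_ge1 B_lt1.
have [M M_gt0 bM] := at_zero_ltey b_ni b_zero.
have [M' BM'] := sv_mul_bounded B_SV.
split; first exact: Kspace_sum bM BM'.
have B_zero := glued_at_zero c_pos beta_ni beta_zero B_lt1.
have B_infty e : 0 < e -> exists2 N, 0 < N & forall t, N <= t -> B t <= e.
  move=> e0; have [N N0 H] := at_infty_eq0 b_ni b_infty e0.
  exists (Num.max N 1); first by rewrite lt_max N0.
  by move=> t; rewrite ge_max => /andP[Nt t1]; rewrite B_ge1// H.
have phi_nd := reciprocal_nd B_gt0 B_ni.
have [psi [mpsi psi0 ipsi dpsi]] := ac_derivative phi_nd
  (reciprocal_continuous B_gt0 B_ni B_AC B_zero) (@reciprocal_pos0 R B)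
  (reciprocal_cvgy B_gt0 B_infty) (reciprocal_ac B_gt0 B_ni B_AC).
have P : increasing_primitive (reciprocal_pos B) psi.
  split => //; first exact: reciprocal_pos0.
  exact: (reciprocal_gt0 B_gt0).
have [C G] := sv_sqrt_growth B_SV.
apply: (Kspace_Jspace s0 (sum_seminormed s0 s1) P G) => //.
- exact: (reciprocal_range B_gt0 B_ni B_AC B_zero B_infty).
- exact: reciprocal_posE.
- move: A_def dpsi; apply: filterS2; first exact: (ae_filter_ringOfSetsType lebesgue_measure).
  move=> s HA Hd s_gt0; have [ds es] := Hd s_gt0.
  by rewrite HA//; exact: reciprocal_weightE.
Qed.
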